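(* For every integer $m>0$ there exist smooth convex hypersurfaces $X_1,X_2,X_3,X_4\subset\mathbb{R}\mathrm{P}^3$ such that the intersection $\Omega_1(X_1)\cap\Omega_1(X_2)\cap\Omega_1(X_3)\cap\Omega_1(X_4)\subset\mathbb{G}(1,3)$ is transverse and consists of at least $m$ lines.
   Context: A subset $C\subset\mathbb{R}\mathrm{P}^n$ is (strictly) convex if it does not intersect some hyperplane $L$ and is (strictly) convex in the affine chart $\mathbb{R}\mathrm{P}^n\setminus L\simeq\mathbb{R}^n$. A smooth hypersurface $X\subset\mathbb{R}\mathrm{P}^n$ is convex if it bounds a strictly convex open set of $\mathbb{R}\mathrm{P}^n$. $\mathbb{G}(1,3)$ is the ($4$-dimensional) Grassmannian of projective lines in $\mathbb{R}\mathrm{P}^3$, and $\Omega_1(X)\subset\mathbb{G}(1,3)$ is the set of lines tangent to $X$ at some point, i.e. of lines $\Lambda$ with $x\in\Lambda$ and $T_x\Lambda\subset T_xX$ for some $x\in X$. The intersection is transverse if at each of its points the sets $\Omega_1(X_i)$ are smooth hypersurfaces of $\mathbb{G}(1,3)$ intersecting transversally. *)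

(* Defs.v *)
From HB Require Import structures.
From mathcomp Require Import all_boot all_order all_algebra.
From mathcomp Require Import all_classical all_reals all_analysis.

Set Implicit Arguments.
Unset Strict Implicit.
Unset Printing Implicit Defensive.

Import Order.TTheory GRing.Theory Num.Theory.
Import numFieldNormedType.Exports.

Local Open Scope classical_set_scope.
Local Open Scope ring_scope.

Section Smooth.
Variables (R : realType) (V : normedModType R).

(* C^k on U, meant for U open and V finite-dimensional. *)
Fixpoint Ck (k : nat) (U : set V) (f : V -> R^o) : Prop :=
  if k is k'.+1 then
    (forall x, U x -> differentiable f x) /\
    (forall v, Ck k' U (fun x => 'D_v f x))
  else forall x, U x -> {for x, continuous f}.

Definition smooth_on (U : set V) (f : V -> R^o) : Prop := forall k, Ck k U f.

(* The boundary contains no segment. The closure is essential: asked only of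
   points of an open set K, the condition would be plain convexity. *)
Definition strictly_convex_set (K : set V) : Prop :=
  forall a b, closure K a -> closure K b -> a <> b ->
  forall t : R, 0 < t < 1 -> interior K ((1 - t) *: a + t *: b).

End Smooth.

Definition rowspan (R : realType) (m n : nat) (A : 'M[R]_(m, n)) :
  {vspace 'rV[R]_n} := <<[seq row i A | i : 'I_m]>>%VS.

(* G(k,n), the projective k-planes of RP^n, as the (k+1)-dimensional linear
   subspaces of R^(n+1). *)
Definition Grass (R : realType) (k n : nat) : Type :=
  {V : {vspace 'rV[R]_n.+1} | \dim V == k.+1}.

HB.instance Definition _ (R : realType) (k n : nat) :=
  Choice.on (Grass R k n).

(* The rows of P and Q together form a basis of R^(n+1) (when k <= n). *)
Definition frame (R : realType) (k n : nat)
  (P : 'M[R]_(k.+1, n.+1)) (Q : 'M[R]_(n - k, n.+1)) : Prop :=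
  row_full (col_mx P Q).

(* The trace of S in the standard affine chart of G(k,n) attached to a frame
   (P, Q), in which A is the coordinate of the row space of P + A Q. The chart
   is centered at the row space of P. For k = 0 it is the affine chart of RP^n
   complementary to the hyperplane spanned by the rows of Q. *)
Definition in_chart (R : realType) (k n : nat)
  (P : 'M[R]_(k.+1, n.+1)) (Q : 'M[R]_(n - k, n.+1)) (S : set (Grass R k n)) :
  set 'M[R]_(k.+1, n - k) :=
  [set A | exists2 V, S V & val V = rowspan (P + A *m Q)].

Definition grass_open (R : realType) (k n : nat) (S : set (Grass R k n)) : Prop :=
  forall P Q, frame P Q -> open (in_chart P Q S).

Lemma mem_rowspan (R : realType) (m n : nat) (A : 'M[R]_(m, n)) (w : 'rV[R]_n) :
  (w \in rowspan A) = (w <= A)%MS.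
Proof.
apply/idP/idP.
  move=> /coord_span ->; apply: summx_sub => i _; apply: scalemx_sub.
  have : [seq row i A | i : 'I_m]`_i \in [seq row i A | i : 'I_m].
    by apply: mem_nth; rewrite size_image ltn_ord.
  by case/mapP => j _ ->; apply: row_sub.
case/submxP => u ->; rewrite mulmx_sum_row.
apply: memv_suml => i _; apply: memvZ; apply: memv_span.
by apply/mapP; exists i; rewrite ?mem_enum.
Qed.

Lemma dim_rowspan (R : realType) (m n : nat) (A : 'M[R]_(m, n)) :
  row_free A -> \dim (rowspan A) = m.
Proof.
move=> fA.
have sz : size [seq row i A | i : 'I_m] = m by rewrite size_map size_enum_ord.
suff fr : free [seq row i A | i : 'I_m] by rewrite (eqP fr).
pose X : m.-tuple 'rV[R]_n := [tuple row i A | i < m].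
have -> : [seq row i A | i : 'I_m] = tval X by [].
apply/freeP => c /= h i.
have : (\row_j c j) *m A = 0.
  rewrite mulmx_sum_row -[RHS]h; apply: eq_bigr => j _.
  rewrite mxE /image_mem (nth_map j) ?nth_ord_enum //.
  by rewrite size_enum_ord.
move/row_freeP: fA => [B AB] /(congr1 (mulmx^~ B)).
by rewrite -mulmxA AB mulmx1 mul0mx => /rowP /(_ i); rewrite !mxE.
Qed.

Lemma frame_row_free (R : realType) (k n : nat)
  (P : 'M[R]_(k.+1, n.+1)) (Q : 'M[R]_(n - k, n.+1)) (A : 'M[R]_(k.+1, n - k)) :
  (k <= n)%N -> frame P Q -> row_free (P + A *m Q).
Proof.
move=> kn fPQ.
have PQ : row_free (col_mx P Q).
  by rewrite /row_free (eqP fPQ) addSn subnKC.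
have -> : P + A *m Q = row_mx 1%:M A *m col_mx P Q.
  by rewrite mul_row_col mul1mx.
rewrite /row_free mxrankMfree //.
apply/row_freeP; exists (col_mx 1%:M 0).
by rewrite mul_row_col mulmx0 addr0 mul1mx.
Qed.

Section Topology.
Variables (R : realType) (k n : nat).

Lemma grass_openT : grass_open [set: Grass R k n].
Proof.
move=> P Q fPQ; case: (leqP k n) => kn; last first.
  rewrite (_ : in_chart _ _ _ = set0); first exact: open0.
  rewrite -subset0 => A [[V /= /eqP dV] _ _].
  by have := dimvS (subvf V); rewrite dV dimvf dim_matrix mul1r leqNgt ltnS kn.
rewrite (_ : in_chart _ _ _ = setT); first exact: openT.
rewrite -subTset => A _.
have dA := dim_rowspan (frame_row_free A kn fPQ).
by exists (exist _ (rowspan (P + A *m Q)) (introT eqP dA) : Grass R k n).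
Qed.

Lemma grass_openI : setI_closed (@grass_open R k n).
Proof.
move=> S T oS oT P Q fPQ.
rewrite (_ : in_chart P Q _ = in_chart P Q S `&` in_chart P Q T).
  by apply: openI; [exact: oS|exact: oT].
apply/seteqP; split => A; first by case=> V [SV TV] e; split; exists V.
case=> [[V SV eV] [W TW eW]]; exists V => //; split=> //.
by rewrite (_ : V = W) //; apply: val_inj; rewrite eV eW.
Qed.

Lemma grass_open_bigU (I : Type) (f : I -> set (Grass R k n)) :
  (forall i, grass_open (f i)) -> grass_open (\bigcup_i f i).
Proof.
move=> of_ P Q fPQ.
rewrite (_ : in_chart P Q _ = \bigcup_i in_chart P Q (f i)).
  by apply: bigcup_open => i _; exact: of_.
apply/seteqP; split => A; first by case=> V [i _ fV] e; exists i => //; exists V.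
by case=> i _ [V fV e]; exists V => //; exists i.
Qed.

End Topology.

HB.instance Definition _ (R : realType) (k n : nat) :=
  @isOpenTopological.Build (Grass R k n) (@grass_open R k n)
    (@grass_openT R k n) (@grass_openI R k n) (@grass_open_bigU R k n).

Definition RP (R : realType) (n : nat) : Type := Grass R 0 n.

HB.instance Definition _ (R : realType) (n : nat) := Topological.on (RP R n).

Section Submanifolds.
Variables (R : realType) (k n : nat).

Definition centered_frame (p : Grass R k n)
  (P : 'M[R]_(k.+1, n.+1)) (Q : 'M[R]_(n - k, n.+1)) : Prop :=
  frame P Q /\ rowspan P = val p.

(* Near the center of the chart (P, Q), S is a smooth submanifold of
   codimension c through that center: the zero set of c smooth functions whose
   differentials there are independent, i.e. have a common kernel of
   codimension c. T is this kernel, the tangent space in chart coordinates. *)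
Definition has_tangent_space
  (P : 'M[R]_(k.+1, n.+1)) (Q : 'M[R]_(n - k, n.+1))
  (c : nat) (S : set (Grass R k n)) (T : {vspace 'M[R]_(k.+1, n - k)}) : Prop :=
  exists (U : set 'M[R]_(k.+1, n - k))
         (phi : 'I_c -> 'M[R]_(k.+1, n - k) -> R^o),
    [/\ open U /\ U 0,
        forall i, smooth_on U (phi i),
        in_chart P Q S 0 /\
        (forall A, U A -> (in_chart P Q S A <-> forall i, phi i A = 0)),
        forall v, v \in T <-> forall i, 'd (phi i) 0 v = 0 &
        (\dim T + c = \dim {:'M[R]_(k.+1, n - k)})%N].

Definition smooth_hypersurface (X : set (Grass R k n)) : Prop :=
  forall p, X p -> exists P Q (T : {vspace 'M[R]_(k.+1, n - k)}),
    centered_frame p P Q /\ has_tangent_space P Q 1 X T.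

(* Near p each S i is a smooth hypersurface through p, and the intersection of
   their tangent spaces at p has codimension N, the sum of their codimensions. *)
Definition transverse_hypersurfaces_at (N : nat)
  (S : 'I_N -> set (Grass R k n)) (p : Grass R k n) : Prop :=
  exists P Q (T : 'I_N -> {vspace 'M[R]_(k.+1, n - k)}),
    [/\ centered_frame p P Q,
        forall i, has_tangent_space P Q 1 (S i) (T i) &
        (\dim (\bigcap_i T i)%VS + N = \dim {:'M[R]_(k.+1, n - k)})%N].

Definition transverse_intersection (N : nat)
  (S : 'I_N -> set (Grass R k n)) : Prop :=
  forall p, (forall i, S i p) -> transverse_hypersurfaces_at S p.

End Submanifolds.

Section ConvexHypersurfaces.
Variables (R : realType) (n : nat).

Definition points_of (k : nat) (L : Grass R k n) : set (RP R n) :=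
  [set x | (val x <= val L)%VS].

(* The row space of Q is the hyperplane that C avoids. *)
Definition strictly_convex (C : set (RP R n)) : Prop :=
  exists L : {vspace 'rV[R]_n.+1},
    [/\ \dim L = n,
        forall x, C x -> ~~ (val x <= L)%VS &
        exists P Q, [/\ frame P Q, rowspan Q = L &
                        strictly_convex_set (in_chart P Q C)]].

Definition convex_hypersurface (X : set (RP R n)) : Prop :=
  smooth_hypersurface X /\
  exists C : set (RP R n),
    [/\ open C, strictly_convex C & X = closure C `\` interior C].

(* The projective line Lambda has codimension n - 1 in RP^n. *)
Definition tangent_at (Lambda : Grass R 1 n) (X : set (RP R n)) (x : RP R n) :
  Prop :=
  exists P Q (TL TX : {vspace 'M[R]_(1, n - 0)}),
    [/\ centered_frame x P Q,
        has_tangent_space P Q (n - 1) (points_of Lambda) TL,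
        has_tangent_space P Q 1 X TX & (TL <= TX)%VS].

Definition Omega1 (X : set (RP R n)) : set (Grass R 1 n) :=
  [set Lambda | exists x, [/\ X x, points_of Lambda x & tangent_at Lambda X x]].

End ConvexHypersurfaces.

(* Main.v *)
From HB Require Import structures.
Require Import Defs.
From mathcomp Require Import all_boot all_order all_algebra.
From mathcomp Require Import all_classical all_reals all_analysis.
From mathcomp Require Import ring lra.

Set Implicit Arguments.
Unset Strict Implicit.
Unset Printing Implicit Defensive.

Import Order.TTheory GRing.Theory Num.Theory.
Import numFieldNormedType.Exports.

Local Open Scope classical_set_scope.
Local Open Scope ring_scope.

(** Take the unit sphere about 0 and the two spheres of squared radius 3 about
    (0, 0, 2) and (0, 0, -2). The lines tangent to all three are exactly the
    rulings of the hyperboloid x^2 + y^2 = 1 + z^2 ([tangent_three_spheres],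
    [common_lines]): two one-parameter families, distinguished by a sign s and
    parametrized by the point (a, b, 0) of the waist circle. The fourth surface
    is the corrugated unit sphere x^2 + y^2 + z^2 = 1 + eps cos (N x). On the
    ruling through (a, b, 0) the minimum of its equation is - eps when
    cos (N a) = 1 and eps when cos (N a) = -1, hence vanishes for some a in
    between, and the ruling is then tangent ([wave_root]). For N = 2 pi m this
    happens on m disjoint intervals ([config_many]). Since eps N^2 = 1/2, the
    corrugation does not destroy strict convexity.

    A tangent line of the surface f = 0, with f strictly convex, is a line on
    which the minimum of f is 0, i.e. one spanned by a point x and a direction v
    with f x = 0 and df_x v = 0. The definition of tangency allows arbitrary
    charts and equations, so this description ([Omega1_ovalP]) rests on the fact
    that two equations of the same hypersurface have the same tangent space
    ([tangent_zero_set]). The point where f is minimal on a line depends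
    smoothly on the line: its parameter is the root of an equation of Kepler
    type ([kepler_smooth]). So near a tangent line the tangent lines are the
    zeros of a smooth function on the Grassmannian, whose differential is the
    derivative of f along the displacement of the line at the contact point
    ([diff_depth], [Omega1_has_tangent_space]).

    At a common tangent line, the differentials that belong to the three spheres
    have a one-dimensional common kernel, the infinitesimal rotation of the
    ruling about the z-axis. The fourth differential does not vanish on it,
    because the derivative of cos (N x) along this rotation is
    N y sin (N x), and neither factor can vanish at the contact point
    ([wave_transverse], where cos N = 1 is used). *)

(** * Smooth functions *)

Section SmoothCalculus.
Context {R : realType} {V : normedModType R}.
Implicit Types (f g : V -> R^o) (k : nat).

Local Notation C k f := (Ck k [set: V] f).

Lemma CkP k f : (forall x, differentiable f x) ->
  (forall v, C k (fun x => 'D_v f x)) -> C k.+1 f.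
Proof. by move=> df dkf; split. Qed.

Lemma Ck_differentiable k f x : C k.+1 f -> differentiable f x.
Proof. by move=> [+ _]; apply. Qed.

Lemma Ck_derive k f v : C k.+1 f -> C k (fun x => 'D_v f x).
Proof. by move=> [_]; apply. Qed.

Lemma CkW k f : C k.+1 f -> C k f.
Proof.
elim: k f => [|k IH] f cf.
  by move=> x _; apply: differentiable_continuous; apply: Ck_differentiable cf.
by apply: CkP => [x|v]; [exact: Ck_differentiable cf|apply: IH; exact: Ck_derive].
Qed.

Lemma Ck_cst k (c : R) : C k (fun=> c).
Proof.
elim: k c => [|k IH] c; first by move=> x _; exact: cvg_cst.
apply: CkP => [x|v]; first exact: differentiable_cst.
under eq_fun do rewrite derive_cst.
exact: IH.
Qed.

Lemma CkD k f g : C k f -> C k g -> C k (fun x => f x + g x).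
Proof.
elim: k f g => [|k IH] f g cf cg.
  by move=> x _; apply: continuousD; [exact: cf|exact: cg].
apply: CkP => [x|v].
  by apply: differentiableD; [exact: Ck_differentiable cf|exact: Ck_differentiable cg].
rewrite (_ : (fun x => _) = fun x => 'D_v f x + 'D_v g x).
  by apply: IH; exact: Ck_derive.
apply: funext => x; rewrite -[LHS]/('D_v (f + g) x) deriveD //.
  by apply: diff_derivable; exact: Ck_differentiable cf.
by apply: diff_derivable; exact: Ck_differentiable cg.
Qed.

Lemma CkM k f g : C k f -> C k g -> C k (fun x => f x * g x).
Proof.
elim: k f g => [|k IH] f g cf cg.
  by move=> x _; apply: continuousM; [exact: cf|exact: cg].
have df x := Ck_differentiable x cf.
have dg x := Ck_differentiable x cg.
apply: CkP => [x|v]; first exact: differentiableM.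
rewrite (_ : (fun x => _) = fun x => f x * 'D_v g x + g x * 'D_v f x).
  by apply: CkD; apply: IH; by [exact: CkW|exact: Ck_derive].
apply: funext => x; rewrite -[LHS]/('D_v (f * g) x) deriveM //;
  exact: diff_derivable.
Qed.

Lemma CkZ k c f : C k f -> C k (fun x => c * f x).
Proof. by move=> cf; apply: CkM cf; exact: Ck_cst. Qed.

Lemma CkN k f : C k f -> C k (fun x => - f x).
Proof.
move=> cf; under eq_fun do rewrite -mulN1r.
exact: CkZ.
Qed.

Lemma CkB k f g : C k f -> C k g -> C k (fun x => f x - g x).
Proof. by move=> cf cg; apply: CkD => //; exact: CkN. Qed.

Lemma CkX k n f : C k f -> C k (fun x => f x ^+ n).
Proof.
move=> cf; elim: n => [|n IH].
  by under eq_fun do rewrite expr0; exact: Ck_cst.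
by under eq_fun do rewrite exprS; exact: CkM.
Qed.

Lemma CkV k f : (forall x, f x != 0) -> C k f -> C k (fun x => (f x)^-1).
Proof.
move=> f0; elim: k f f0 => [|k IH] f f0 cf.
  by move=> x _; apply: continuousV => //; exact: cf.
have df x := Ck_differentiable x cf.
apply: CkP => [x|v]; first exact: differentiableV.
rewrite (_ : (fun x => _) = fun x => - ((f x)^-1 ^+ 2 * 'D_v f x)).
  by apply: CkN; apply: CkM; [apply: CkX; apply: IH => //; exact: CkW|exact: Ck_derive].
apply: funext => x; rewrite deriveV //; last exact: diff_derivable.
by rewrite -[_ *: _]/(_ * _) mulNr exprVn.
Qed.

Lemma diff_sin_comp f x : differentiable f x ->
  is_diff x (fun y => sin (f y) : R^o) (fun v => cos (f x) * 'd f x v).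
Proof.
move=> df.
have ds : differentiable (sin : R^o -> R^o) (f x).
  by apply/derivable1_diffP; exact: derivable_sin.
apply: DiffDef; first exact: (differentiable_comp df ds).
rewrite [LHS](diff_comp df ds).
apply: funext => v /=; rewrite deriv1E; last exact: derivable_sin.
rewrite derive1E; have /(_ (f x))[_ ->] := is_derive_sin (R := R).
by rewrite -[_ *: _]/(_ * _) mulrC.
Qed.

Lemma diff_cos_comp f x : differentiable f x ->
  is_diff x (fun y => cos (f y) : R^o) (fun v => - sin (f x) * 'd f x v).
Proof.
move=> df.
have ds : differentiable (cos : R^o -> R^o) (f x).
  by apply/derivable1_diffP; exact: derivable_cos.
apply: DiffDef; first exact: (differentiable_comp df ds).
rewrite [LHS](diff_comp df ds).
apply: funext => v /=; rewrite deriv1E; last exact: derivable_cos.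
rewrite derive1E; have /(_ (f x))[_ ->] := is_derive_cos (R := R).
by rewrite -[_ *: _]/(_ * _) mulrC.
Qed.

Lemma derive_sin_comp f x v : differentiable f x ->
  'D_v (fun y => sin (f y) : R^o) x = cos (f x) * 'D_v f x.
Proof.
move=> df; have [ds e] := diff_sin_comp df.
by rewrite !deriveE // e.
Qed.

Lemma derive_cos_comp f x v : differentiable f x ->
  'D_v (fun y => cos (f y) : R^o) x = - sin (f x) * 'D_v f x.
Proof.
move=> df; have [ds e] := diff_cos_comp df.
by rewrite !deriveE // e.
Qed.

(** Sine and cosine are each other's derivatives up to sign, so the induction on
    k has to treat them together. *)
Lemma Ck_sin_cos k f : C k f ->
  C k (fun x => sin (f x)) /\ C k (fun x => cos (f x)).
Proof.
elim: k f => [|k IH] f cf.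
  split=> x _; apply: (@continuous_comp _ _ _ f); do ?exact: cf.
    exact: continuous_sin.
  exact: continuous_cos.
have df x := Ck_differentiable x cf.
have [cs cc] := IH _ (CkW cf).
split; apply: CkP => [x|v].
- by have [] := diff_sin_comp (df x).
- under eq_fun do rewrite derive_sin_comp //.
  by apply: CkM => //; exact: Ck_derive.
- by have [] := diff_cos_comp (df x).
- under eq_fun do rewrite derive_cos_comp //.
  by apply: CkM; [exact: CkN|exact: Ck_derive].
Qed.

Lemma Ck_cos k f : C k f -> C k (fun x => cos (f x)).
Proof. by case/Ck_sin_cos. Qed.

Lemma Ck_linear k (l : {linear V -> R^o}) : continuous l -> C k l.
Proof.
move=> cl; case: k => [|k]; first by move=> x _; exact: cl.
apply: CkP => [x|v]; first exact: linear_differentiable.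
rewrite (_ : (fun x => _) = fun=> l v); first exact: Ck_cst.
apply: funext => x; rewrite deriveE ?diff_lin //.
exact: linear_differentiable.
Qed.

End SmoothCalculus.

Section Shift.
Context {R : realType} {V : normedModType R}.
Implicit Types (f : V -> R^o).

Lemma derive_shiftl f x A v : 'D_v (fun B => f (x + B)) A = 'D_v f (x + A).
Proof.
rewrite /derive [X in X @ _](_ : _ =
  fun h => h^-1 *: ((f \o shift (x + A)) (h *: v) - f (x + A))) //.
by apply: funext => h /=; rewrite addrCA.
Qed.

Lemma differentiable_shiftl f x A :
  differentiable f (x + A) -> differentiable (fun B => f (x + B)) A.
Proof.
by move=> df; apply: (@differentiable_comp _ _ _ _ (fun B => x + B) f).
Qed.

Lemma diff_shiftl f x A v : differentiable f (x + A) ->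
  'd (fun B => f (x + B)) A v = 'd f (x + A) v.
Proof.
move=> df; have ds := differentiable_shiftl df.
by rewrite -(deriveE v df) -(deriveE v ds); exact: derive_shiftl.
Qed.

Lemma Ck_shiftl k f x : Ck k setT f -> Ck k setT (fun B => f (x + B)).
Proof.
elim: k f => [|k IH] f cf.
  move=> A _; apply: (@continuous_comp _ _ _ (fun B => x + B) f); last exact: cf.
  by apply: (@continuousD R V) => //; exact: cst_continuous.
apply: CkP => [A|v].
  by apply: differentiable_shiftl; exact: Ck_differentiable cf.
under eq_fun do rewrite derive_shiftl.
by apply: (IH (fun x => 'D_v f x)); exact: Ck_derive.
Qed.

End Shift.

Section VanishingProduct.
Context {R : realType} {V W : normedModType R}.

Lemma near_diff (u : V -> W) x e : differentiable u x -> 0 < e ->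
  \forall h \near (0 : V), `|u (x + h) - u x - 'd u x h| <= e * `|h|.
Proof.
move=> du e0; have := diff_locally du.
move=> /eqaddoP /(_ e e0); apply: filterS => h.
rewrite !fctE /= opprD addrA; congr (`|_ - _ - _| <= _).
by rewrite addrC.
Qed.

(** A product rule that asks only continuity of w: as u vanishes at x, the
    increment of w is multiplied by a small quantity. It gives the
    differentiability of implicit functions and of projective changes of
    coordinates, whose denominators play the role of w. *)
Lemma is_diff_vanishZ (u : V -> W) (w : V -> R^o) x : u x = 0 ->
  differentiable u x -> {for x, continuous w} ->
  is_diff x (fun y => w y *: u y) (fun v => w x *: 'd u x v).
Proof.
move=> ux0 du cw.
have lin : linear (fun v => w x *: 'd u x v).
  by move=> a p q; rewrite linearP scalerDr !scalerA mulrC.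
pose L : {linear V -> W} := HB.pack (fun v => w x *: 'd u x v)
  (GRing.isLinear.Build _ _ _ _ _ lin).
have cL : continuous L.
  by move=> y; apply: continuousZl_tmp; exact: diff_continuous.
suff E : (fun y => w y *: u y) \o shift x = cst (w x *: u x) + L +o_ 0 id.
  apply: DiffDef; last exact: (diff_unique cL E).
  by apply/diff_locallyP; rewrite (diff_unique cL E); split.
apply/eqaddoP => e e0.
have [C C0 Clip] : exists2 C, 0 < C & forall h, `|'d u x h| <= C * `|h|.
  exact: (linear_lipschitz (diff_continuous du)).
pose r := e / (2 * (`|w x| + 1)).
have r0 : 0 < r by rewrite divr_gt0 // mulr_gt0 // ltr_wpDl.
pose d := Num.min 1 (e / (2 * C)).
have d0 : 0 < d by rewrite lt_min ltr01 divr_gt0 // mulr_gt0.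
have cw' : \forall h \near (0 : V), `|w (x + h) - w x| < d.
  have /cvgrPdist_lt /(_ d d0) := cw.
  by move=> /nbhs0P; apply: filterS => h /=; rewrite distrC.
near=> h.
have h1 : `|u (x + h) - u x - 'd u x h| <= r * `|h|.
  by near: h; exact: near_diff.
have h2 : `|w (x + h) - w x| < d by near: h.
rewrite !fctE /= ux0 scaler0 add0r [h + x]addrC.
rewrite ux0 subr0 in h1.
have -> : w (x + h) *: u (x + h) - w x *: 'd u x h =
    w (x + h) *: (u (x + h) - 'd u x h) + (w (x + h) - w x) *: 'd u x h.
  by rewrite scalerBr scalerBl addrA subrK.
apply: le_trans (ler_normD _ _) _; rewrite !normrZ.
have h3 : `|w (x + h)| <= `|w x| + 1.
  rewrite -[w (x + h)](subrK (w x)) addrC.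
  apply: le_trans (ler_normD _ _) _; rewrite lerD2l.
  by apply: ltW; apply: lt_le_trans h2 _; rewrite ge_min lexx.
have h4 : `|w (x + h) - w x| <= e / (2 * C).
  by apply: ltW; apply: lt_le_trans h2 _; rewrite ge_min lexx orbT.
have -> : e * `|h| = (`|w x| + 1) * (r * `|h|) + e / (2 * C) * (C * `|h|).
  rewrite /r; field.
  by rewrite gt_eqF //= gt_eqF // ltr_wpDl.
by apply: lerD; apply: ler_pM.
Unshelve. all: by end_near.
Qed.

End VanishingProduct.

(** * A Kepler equation and its smooth root *)

Section Trigonometry.
Context {R : realType}.
Implicit Types x y h : R.

Lemma sin_lip x y : `|sin x - sin y| <= `|x - y|.
Proof.
wlog le : x y / y <= x => [H|].
  have [/H//|/ltW /H] := leP y x.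
  by rewrite distrC [leRHS]distrC.
have [|c _ ->] := MVT_segment le (f := sin) (df := cos).
  by apply: continuous_subspaceT => z; exact: continuous_sin.
by rewrite normrM ler_piMl // cos_max.
Qed.

(** By the mean value theorem for the cosine, then for the sine. It bounds how
    much convexity a corrugation - eps cos (N x) can take away. *)
Lemma cos_upper x h : cos (x + h) <= cos x - h * sin x + h ^+ 2.
Proof.
have [c ch E] : exists2 c, `|c - x| <= `|h| & cos (x + h) - cos x = - sin c * h.
  have [h0|h0] := leP 0 h.
    have [||c + E] := @MVT_segment _ cos (fun z => - sin z) x (x + h).
    - by rewrite lerDl.
    - by apply: continuous_subspaceT => z; exact: continuous_cos.
    rewrite in_itv /= => /andP[c1 c2]; exists c.
      by rewrite !ger0_norm ?subr_ge0 // lerBlDl.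
    by rewrite E; ring.
  have [||c + E] := @MVT_segment _ cos (fun z => - sin z) (x + h) x.
  - by rewrite gerDl ltW.
  - by apply: continuous_subspaceT => z; exact: continuous_cos.
  rewrite in_itv /= => /andP[c1 c2]; exists c.
    rewrite distrC [`|h|]ltr0_norm // ger0_norm ?subr_ge0 //; lra.
  by rewrite -opprB E; ring.
have : `|(sin c - sin x) * h| <= h ^+ 2.
  rewrite normrM -real_normK ?num_real // expr2 ler_wpM2r //.
  exact: le_trans (sin_lip _ _) ch.
rewrite ler_norml => /andP[+ _]; lra.
Qed.

End Trigonometry.

Section Kepler.
Context {R : realType}.
Implicit Types a b d al be t : R.

(** The derivative along a line of the equation of a corrugated sphere has this
    form, t being the parameter on the line. For a = be = 1 it is Kepler's
    equation of celestial mechanics. *)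
Definition kepler a b d al be t := a * t + b + d * (be * sin (al + t * be)).

(** The sine term has slope at most |d| be^2 in t. When this is less than a, the
    function is uniformly increasing, whence existence, uniqueness and
    continuity of its root. *)
Lemma kepler_incr a b d al be t1 t2 : t1 <= t2 ->
  (a - `|d| * be ^+ 2) * (t2 - t1) <=
  kepler a b d al be t2 - kepler a b d al be t1.
Proof.
move=> le; set s := sin (al + t2 * be) - sin (al + t1 * be).
have -> : kepler a b d al be t2 - kepler a b d al be t1 =
    a * (t2 - t1) + d * be * s by rewrite /kepler /s; ring.
have : `|d * be * s| <= `|d| * be ^+ 2 * (t2 - t1).
  rewrite !normrM -[be ^+ 2]real_normK ?num_real // expr2 -!mulrA.
  rewrite !ler_wpM2l // -[t2 - t1]ger0_norm ?subr_ge0 // -normrM.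
  apply: le_trans (sin_lip _ _) _.
  by rewrite le_eqVlt; apply/orP; left; apply/eqP; congr `|_|; ring.
rewrite ler_norml => /andP[+ _]; lra.
Qed.

Lemma kepler_dist a b d al be t1 t2 :
  (a - `|d| * be ^+ 2) * `|t2 - t1| <=
  `|kepler a b d al be t2 - kepler a b d al be t1|.
Proof.
wlog le : t1 t2 / t1 <= t2 => [H|].
  have [/H//|/ltW/H] := leP t1 t2.
  by rewrite distrC [leRHS]distrC.
apply: le_trans (ler_norm _); rewrite [`|t2 - t1|]ger0_norm ?subr_ge0 //.
exact: kepler_incr.
Qed.

Lemma kepler_inj a b d al be t1 t2 : `|d| * be ^+ 2 < a ->
  kepler a b d al be t1 = 0 -> kepler a b d al be t2 = 0 -> t1 = t2.
Proof.
move=> c0 e1 e2; have := kepler_dist a b d al be t1 t2.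
rewrite e1 e2 subrr normr0 pmulr_rle0 ?subr_gt0 // normr_le0 subr_eq0.
by move/eqP.
Qed.

Lemma kepler_cts (T : topologicalType) (a b al be t : T -> R^o) (d : R) s :
  {for s, continuous a} -> {for s, continuous b} ->
  {for s, continuous al} -> {for s, continuous be} -> {for s, continuous t} ->
  {for s, continuous
    (fun u => kepler (a u) (b u) d (al u) (be u) (t u) : R^o)}.
Proof.
move=> ca cb cal cbe ct; rewrite /kepler.
apply: (@continuousD R R^o).
  by apply: (@continuousD R R^o) => //; apply: continuousM.
apply: continuousM; first exact: cvg_cst.
apply: continuousM => //.
apply: (@continuous_comp _ _ _ (fun u => al u + t u * be u) sin).
  by apply: continuousD => //; apply: continuousM.
exact: continuous_sin.
Qed.

Lemma kepler_exists a b d al be : `|d| * be ^+ 2 < a ->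
  exists t, kepler a b d al be t = 0.
Proof.
move=> c0; pose F := kepler a b d al be.
pose c := a - `|d| * be ^+ 2; have {}c0 : 0 < c by rewrite subr_gt0.
(* As the slope is at least c, the sign has changed at distance M from 0. *)
pose M := `|F 0| / c.
have M0 : 0 <= M by rewrite divr_ge0 // ltW.
have cM : c * M = `|F 0| by rewrite /M mulrC divfK // gt_eqF.
have F0 := ler_norm (F 0); have F0' := ler_norm (- F 0); rewrite normrN in F0'.
have H1 := kepler_incr a b d al be M0.
have H2 := @kepler_incr a b d al be (- M) 0.
rewrite oppr_le0 in H2; have {}H2 := H2 M0.
rewrite -/(F 0) -/(F M) -/(F (- M)) -/c subr0 cM in H1.
rewrite -/(F 0) -/(F M) -/(F (- M)) -/c sub0r opprK cM in H2.
have [|||t _ Ft] := @IVT _ F (- M) M 0.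
- by rewrite ge0_cp.
- apply: continuous_subspaceT => t.
  by apply: (@kepler_cts R (fun=> a) (fun=> b) (fun=> al) (fun=> be) id d t);
    do ?exact: cvg_cst; exact: cvg_id.
- by rewrite ge_min le_max; apply/andP; split; apply/orP; [left|right]; lra.
by exists t.
Qed.

End Kepler.

Section KeplerFamily.
Context {R : realType}.

(** The distance from the root at s to the root at u is at most the value at
    t s of the function that belongs to u, divided by its least slope. *)
Lemma kepler_continuous (T : topologicalType) (a b al be t : T -> R^o) (d : R) s :
  {for s, continuous a} -> {for s, continuous b} ->
  {for s, continuous al} -> {for s, continuous be} ->
  (forall s, `|d| * be s ^+ 2 < a s) ->
  (forall s, kepler (a s) (b s) d (al s) (be s) (t s) = 0) ->
  {for s, continuous t}.
Proof.
move=> ca cb cal cbe c0 kt.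
pose q u : R^o := `|kepler (a u) (b u) d (al u) (be u) (t s)| /
            (a u - `|d| * be u ^+ 2).
have q0 : q s = 0 by rewrite /q kt normr0 mul0r.
have cc : {for s, continuous (fun u => a u - `|d| * be u ^+ 2 : R^o)}.
  apply: (@continuousB R R^o) => //; apply: continuousM; first exact: cvg_cst.
  by rewrite [X in {for _, continuous X}](_ : _ = be * be) //; exact: continuousM.
have cq : {for s, continuous q}.
  apply: continuousM; last by apply: continuousV => //; rewrite gt_eqF // subr_gt0.
  apply: (@continuous_comp _ _ _ _ (fun x : R^o => `|x|)); last exact: norm_continuous.
  by apply: kepler_cts => //; exact: cvg_cst.
apply/cvgrPdist_le => e e0.
have /cvgrPdist_le /(_ e e0) := cq.
apply: filterS => u; rewrite q0 sub0r normrN => qe.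
apply: le_trans qe; apply: le_trans (ler_norm _).
rewrite /q ler_pdivlMr ?subr_gt0 // mulrC.
apply: le_trans (kepler_dist _ (b u) _ (al u) _ _ _) _.
by rewrite kt subr0.
Qed.

Section Smooth.
Variables (V : normedModType R) (d : R) (a b al be t : V -> R^o).
Hypothesis slope : forall s, `|d| * be s ^+ 2 < a s.
Hypothesis root : forall s, kepler (a s) (b s) d (al s) (be s) (t s) = 0.

(** For x a cosine this is a t-derivative of [kepler]; the bound on x also
    covers the difference quotients of the sine. *)
Lemma kepler_denom s x : `|x| <= 1 -> 0 < a s + d * be s ^+ 2 * x.
Proof.
move=> x1; have : `|d * be s ^+ 2 * x| <= `|d| * be s ^+ 2.
  rewrite 2!normrM [`|be s ^+ 2|]ger0_norm ?sqr_ge0 // ler_piMr //.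
  by rewrite mulr_ge0 // sqr_ge0.
rewrite ler_norml => /andP[+ _]; have := slope s; lra.
Qed.

(** With Caratheodory's form of the derivative, sin (W u) - sin (W s) =
    D (W u) * (W u - W s) where D is continuous and |D| <= 1. The difference of
    the equations at u and at s is then linear in t u - t s, with a nonzero
    coefficient q u, and t - t s is a sum of continuous multiples of
    differentiable functions that vanish at s. *)
Lemma kepler_differentiable s :
  differentiable a s -> differentiable b s ->
  differentiable al s -> differentiable be s -> differentiable t s.
Proof.
move=> da db dal dbe.
have [ca cb cal cbe] : [/\ {for s, continuous a}, {for s, continuous b},
    {for s, continuous al} & {for s, continuous be}].
  by split; exact: differentiable_continuous.
have ct : {for s, continuous t} by exact: (kepler_continuous _ _ _ _ slope root).
pose W u : R^o := al u + t u * be u.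
have cW : {for s, continuous W}.
  by apply: (@continuousD R R^o) => //; exact: continuousM.
have [D [DE cD D0]] := (is_derive1_caratheodory _ _ _).1 (is_derive_sin (W s)).
have cDW : {for s, continuous (fun u => D (W u) : R^o)}.
  by apply: (@continuous_comp _ _ _ W D).
have D1 z : `|D z| <= 1.
  have [->|zW] := eqVneq z (W s); first by rewrite D0 cos_max.
  rewrite -(@ler_pM2r _ `|z - W s|) ?normr_gt0 ?subr_eq0 // mul1r -normrM -DE.
  exact: sin_lip.
pose q u : R^o := a u + d * be u ^+ 2 * D (W u).
have cq : {for s, continuous q}.
  apply: (@continuousD R R^o) => //; apply: continuousM => //.
  apply: continuousM; first exact: cvg_cst.
  by rewrite [X in {for _, continuous X}](_ : _ = be * be) //; exact: continuousM.
have q0 u : q u != 0 by rewrite gt_eqF // kepler_denom.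
pose u1 : V -> R^o := ((a - cst (a s)) * cst (t s) + (b - cst (b s)) +
  cst (d * sin (W s)) * (be - cst (be s))).
pose u2 : V -> R^o := (al - cst (al s)) + (be - cst (be s)) * cst (t s).
pose w1 u : R^o := - (q u)^-1.
pose w2 u : R^o := - (q u)^-1 * (d * be u * D (W u)).
have -> : t = cst (t s) + (fun u => w1 u *: u1 u) + (fun u => w2 u *: u2 u).
  apply: funext => u; rewrite !fctE /u1 /u2 /w1 /w2 /cst /=.
  rewrite -![_ *: _]/(_ * _) !fctE.
  have := root u; have := root s; rewrite /kepler -/(W s) -/(W u) => es eu.
  have E : sin (W u) = sin (W s) + D (W u) * (W u - W s).
    by rewrite -DE addrC subrK.
  have {}eu : q u * (t u - t s) = - ((a u - a s) * t s + (b u - b s) +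
    d * sin (W s) * (be u - be s)) - d * be u * D (W u) *
    ((al u - al s) + (be u - be s) * t s).
    apply/eqP; rewrite -subr_eq0; apply/eqP.
    transitivity (a u * t u + b u + d * (be u * sin (W u)) -
      (a s * t s + b s + d * (be s * sin (W s)))); last by rewrite es eu subr0.
    by rewrite E /q /W; ring.
  rewrite -[LHS](subrK (t s)) -[X in X + _](mulKf (q0 u)) eu.
  by ring.
have cw1 : {for s, continuous w1}.
  by apply: (@continuousN R R^o); exact: continuousV.
have cw2 : {for s, continuous w2}.
  apply: continuousM => //; apply: continuousM => //.
  by apply: continuousM => //; exact: cvg_cst.
have du1 : differentiable u1 s.
  apply: differentiableD; last first.
    by apply: differentiableM => //; apply: differentiableB.
  apply: differentiableD; last exact: differentiableB.
  by apply: differentiableM => //; apply: differentiableB.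
have du2 : differentiable u2 s.
  apply: differentiableD; first exact: differentiableB.
  by apply: differentiableM => //; apply: differentiableB.
have u10 : u1 s = 0 by rewrite /u1 !fctE !subrr mul0r mulr0 !addr0.
have u20 : u2 s = 0 by rewrite /u2 !fctE !subrr mul0r !addr0.
apply: differentiableD; last by have [] := is_diff_vanishZ u20 du2 cw2.
apply: differentiableD; first exact: differentiable_cst.
by have [] := is_diff_vanishZ u10 du1 cw1.
Qed.

Lemma kepler_derive s v :
  differentiable a s -> differentiable b s ->
  differentiable al s -> differentiable be s ->
  'D_v t s = - (t s * 'D_v a s + 'D_v b s +
      d * ('D_v be s * sin (al s + t s * be s) +
           be s * cos (al s + t s * be s) * ('D_v al s + t s * 'D_v be s))) /
    (a s + d * be s ^+ 2 * cos (al s + t s * be s)).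
Proof.
move=> da db dal dbe; have dt := kepler_differentiable da db dal dbe.
have isD (f : V -> R^o) : differentiable f s -> is_derive s v f ('D_v f s).
  by move=> df; apply: derivableP; exact: diff_derivable.
have [ia ib ial ibe it] := And5 (isD _ da) (isD _ db) (isD _ dal) (isD _ dbe) (isD _ dt).
have dW : differentiable (al + t * be) s.
  by apply: differentiableD => //; exact: differentiableM.
have isin : is_derive s v (fun u => sin ((al + t * be) u) : R^o)
    (cos (al s + t s * be s) * 'D_v (al + t * be) s).
  apply: DeriveDef (derive_sin_comp v dW).
  by apply: diff_derivable; have [] := diff_sin_comp dW.
have iW := is_deriveD ial (is_deriveM it ibe).
have iK := is_deriveD (is_deriveD (is_deriveM ia it) ib)
  (is_deriveZ d (is_deriveM ibe isin)).
have eK : a * t + b + d *: (be * (fun u => sin ((al + t * be) u))) = cst 0 :> (V -> R^o).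
  by apply: funext => u; exact: root.
have := @derive_val _ _ _ _ _ _ _ iK.
rewrite [X in 'D_v X _]eK derive_cst (@derive_val _ _ _ _ _ _ _ iW).
rewrite -![_ *: _]/(_ * _) => /esym E.
have c0 := gt_eqF (kepler_denom s (cos_max (al s + t s * be s))).
apply: (canRL (mulfK _)); first by rewrite c0.
apply/eqP; rewrite -subr_eq0 -[X in _ == X]E; apply/eqP; rewrite !fctE.
ring.
Qed.

(** Bootstrap: the derivative of t is an expression in t, the coefficients and
    their derivatives, so t is of class C^(k+1) as soon as it is of class C^k. *)
Lemma kepler_smooth : smooth_on setT a -> smooth_on setT b ->
  smooth_on setT al -> smooth_on setT be -> smooth_on setT t.
Proof.
move=> sa sb sal sbe.
have dif (f : V -> R^o) : smooth_on setT f -> forall s, differentiable f s.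
  by move=> /(_ 1) sf s; exact: Ck_differentiable sf.
have dt s : differentiable t s by apply: kepler_differentiable; exact: dif.
elim=> [|k IH]; first by move=> s _; exact: differentiable_continuous.
apply: CkP => // v.
have tE s := kepler_derive v (dif _ sa s) (dif _ sb s) (dif _ sal s) (dif _ sbe s).
rewrite (funext tE).
have CW : Ck k setT (fun s => al s + t s * be s) by apply: CkD => //; exact: CkM.
have [Cs Cc] := Ck_sin_cos CW.
have [Da Db] := (Ck_derive v (sa k.+1), Ck_derive v (sb k.+1)).
have [Dal Dbe] := (Ck_derive v (sal k.+1), Ck_derive v (sbe k.+1)).
apply: CkM; last first.
  apply: CkV => [s|]; first by rewrite gt_eqF // kepler_denom // cos_max.
  by apply: CkD => //; apply: CkM => //; apply: CkZ; exact: CkX.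
apply: CkN; apply: CkD; first by apply: CkD => //; exact: CkM.
apply: CkZ; apply: CkD; first exact: CkM.
by apply: CkM; [exact: CkM|apply: CkD => //; exact: CkM].
Qed.

End Smooth.
End KeplerFamily.

(** * Linear algebra *)

Lemma lsubmx_rV1 (R : realType) n (w : 'rV[R]_(1 + n)) : lsubmx w = (w 0 0)%:M.
Proof.
rewrite [lsubmx w]mx11_scalar [lsubmx w 0 0]mxE.
by congr (w _ _)%:M; exact: val_inj.
Qed.

Lemma mul_rV2_col_mx (R : realType) n (u u' : 'rV[R]_n) (w : 'rV[R]_(1 + 1)) :
  w *m col_mx u u' = w 0 0 *: u + w 0 1 *: u'.
Proof.
rewrite -{1}[w]hsubmxK mul_row_col lsubmx_rV1 [rsubmx w]mx11_scalar.
rewrite !mul_scalar_mx [rsubmx w 0 0]mxE.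
by congr (_ + w _ _ *: _); exact: val_inj.
Qed.

Lemma rowspanP (R : realType) m m' n (A : 'M[R]_(m, n)) (B : 'M[R]_(m', n)) :
  rowspan A = rowspan B <-> (A :=: B)%MS.
Proof.
split=> [E|E].
  apply/eqmxP/andP; split; apply/rV_subP => u; rewrite -!mem_rowspan ?E //.
by apply/vspaceP => u; rewrite !mem_rowspan E.
Qed.

Lemma rowspan_sub (R : realType) m m' n (A : 'M[R]_(m, n)) (B : 'M[R]_(m', n)) :
  (rowspan A <= rowspan B)%VS = (A <= B)%MS.
Proof.
apply/idP/idP => [/subvP AB|AB].
  by apply/rV_subP => u; rewrite -!mem_rowspan; exact: AB.
by apply/subvP => u; rewrite !mem_rowspan => /submx_trans; exact.
Qed.

Lemma dim_lker_functional (R : realType) (V : vectType R)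
  (l : {linear V -> R^o}) v : l v != 0 -> (\dim (lker (linfun l)) + 1 = \dim {:V})%N.
Proof.
move=> lv; rewrite -(limg_ker_dim (linfun l) fullv) capfv; congr (_ + _)%N.
apply/esym/eqP; rewrite eqn_leq; apply/andP; split.
  by apply: leq_trans (dimvS (subvf _)) _; rewrite dimvf.
rewrite lt0n dimv_eq0; apply: contra lv => /eqP l0.
by rewrite -[l v]lfunE -memv0 -l0 memv_img // memvf.
Qed.

Lemma mx_linear_continuous (R : realType) m n (W : normedModType R)
  (l : {linear 'M[R]_(m, n) -> W}) : continuous l.
Proof.
have -> : l = (fun A : 'M[R]_(m, n) =>
    \sum_i \sum_j A i j *: l (delta_mx i j)) :> (_ -> _).
  apply: funext => A; rewrite [in LHS](matrix_sum_delta A) linear_sum.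
  apply: eq_bigr => i _; rewrite linear_sum; apply: eq_bigr => j _.
  by rewrite linearZ.
have cs (I : Type) (r : seq I) (F : I -> 'M[R]_(m, n) -> W) :
    (forall i, continuous (F i)) -> continuous (fun A => \sum_(i <- r) F i A).
  move=> cF A; elim: r => [|i r IH].
      have -> : (fun A => \sum_(i <- [::]) F i A) = cst 0.
      by apply: funext => B; rewrite big_nil.
    exact: cst_continuous.
  have -> : (fun A => \sum_(i <- i :: r) F i A) =
      F i + (fun A => \sum_(i <- r) F i A).
    by apply: funext => B; rewrite big_cons.
  by apply: continuousD => //; exact: cF.
apply: (cs) => i; apply: (cs) => j A.
by apply: continuousZr_tmp; exact: coord_continuous.
Qed.

(** * The affine chart of projective space *)

Section AffinePoints.
Context {R : realType}.
Implicit Types (x y v : 'rV[R]_3) (w : 'rV[R]_(1 + 3)).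

(** Homogeneous coordinates: [homv x] represents the affine point x, and [dir v]
    the point at infinity of the lines directed by v. With [homv x], the rows of
    [Qstd] form the frame of the chart A |-> x + A. *)
Definition homv x : 'rV[R]_(1 + 3) := row_mx 1%:M x.
Definition dir v : 'rV[R]_(1 + 3) := row_mx 0 v.
Definition Qstd : 'M[R]_(3, 1 + 3) := row_mx 0 1%:M.

Lemma dirD v v' : dir (v + v') = dir v + dir v'.
Proof. by rewrite /dir add_row_mx addr0. Qed.
Lemma dirZ a v : dir (a *: v) = a *: dir v.
Proof. by rewrite /dir scale_row_mx scaler0. Qed.
Lemma homvD x v : homv (x + v) = homv x + dir v.
Proof. by rewrite /homv /dir add_row_mx addr0. Qed.
Lemma mul_Qstd v : v *m Qstd = dir v.
Proof. by rewrite /Qstd mul_mx_row mulmx0 mulmx1. Qed.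

Lemma homv0 x : homv x 0 0 = 1.
Proof. by rewrite -[X in homv x 0 X](lshift0 3 0) row_mxEl mxE eqxx. Qed.
Lemma dir0 v : dir v 0 0 = 0.
Proof. by rewrite -[X in dir v 0 X](lshift0 3 0) row_mxEl mxE. Qed.

Lemma dir_inj : injective dir.
Proof. by move=> u v /eq_row_mx[]. Qed.
Lemma homv_inj : injective homv.
Proof. by move=> u v /eq_row_mx[]. Qed.

Definition dehom w : 'rV[R]_3 := (w 0 0)^-1 *: rsubmx w.

Lemma homv_dehom w : w 0 0 != 0 -> w = w 0 0 *: homv (dehom w).
Proof.
move=> w0; rewrite /homv /dehom scale_row_mx scalerA divff // scale1r.
rewrite -[LHS]hsubmxK; congr row_mx; apply/rowP => i.
by rewrite !ord1 !mxE eqxx mulr1; congr (w _ _); apply: val_inj.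
Qed.

Lemma homv_free x : row_free (homv x).
Proof.
rewrite /row_free rank_rV (_ : homv x != 0) //.
apply/eqP => /matrixP /(_ 0 0) /eqP.
by rewrite homv0 mxE oner_eq0.
Qed.

Lemma affpt_subproof x : \dim (rowspan (homv x) : {vspace 'rV[R]_3.+1}) == 1.
Proof. by rewrite dim_rowspan // homv_free. Qed.

Definition affpt x : RP R 3 := exist _ (rowspan (homv x)) (affpt_subproof x).

Lemma rowspan_homv w x : rowspan w = rowspan (homv x) :> {vspace 'rV[R]_4} <->
  w 0 0 != 0 /\ x = dehom w.
Proof.
split=> [/rowspanP E|[w0 ->]].
  have /sub_rVP[a ha] : (homv x <= w)%MS by rewrite E.
  have e1 : a * w 0 0 = 1.
    by rewrite -[RHS](homv0 x) ha mxE.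
  have w0 : w 0 0 != 0.
    by apply: contra_eq_neq e1 => ->; rewrite mulr0 eq_sym oner_eq0.
  split=> //; apply: homv_inj; apply: (scalerI w0).
  by rewrite -homv_dehom // ha scalerA mulrC e1 scale1r.
apply/rowspanP; rewrite {1}(homv_dehom w0).
exact: eqmx_scale.
Qed.

Lemma affpt_inj : injective affpt.
Proof.
move=> x y /(congr1 val) /= /rowspan_homv[_ ->].
by rewrite /dehom homv0 invr1 scale1r /homv row_mxKr.
Qed.

Lemma in_chart_affpt P Q (S : set 'rV[R]_3) :
  in_chart P Q (affpt @` S) =
  [set A : 'M[R]_(1, 3 - 0) | let w : 'rV[R]_(1 + 3) := P + A *m Q in
            w 0 0 != 0 /\ S (dehom w)].
Proof.
apply/seteqP; split=> A /=.
  by move=> [_ [x Sx <-]] /= /esym/rowspan_homv[w0 <-].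
move=> [w0 Sw]; exists (affpt (dehom (P + A *m Q))); first by exists (dehom (P + A *m Q)).
by apply/esym/rowspan_homv; split.
Qed.

Lemma homv_dir_dehom x v : dehom (homv x + dir v) = x + v.
Proof. by rewrite -homvD /dehom homv0 invr1 scale1r row_mxKr. Qed.

Lemma in_chart_std x (S : set 'rV[R]_3) :
  in_chart (homv x) Qstd (affpt @` S) = [set A | S (x + A)].
Proof.
rewrite in_chart_affpt; apply/seteqP; split=> A /=; rewrite mul_Qstd homv_dir_dehom.
  by case.
by split=> //; rewrite -homvD homv0 oner_eq0.
Qed.

Lemma Qstd_free : row_free Qstd.
Proof.
apply/row_freeP; exists (col_mx 0 1%:M).
by rewrite /Qstd mul_row_col mul0mx add0r mul1mx.
Qed.

Lemma frame_std x : frame (homv x : 'M[R]_(1, 4)) (Qstd : 'M[R]_(3 - 0, 4)).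
Proof.
rewrite /frame -sub1mx.
apply/rV_subP => u _.
have -> : u = row_mx (lsubmx (u : 'rV[R]_(1 + 3)) )
   (rsubmx (u : 'rV[R]_(1 + 3)) - (lsubmx (u : 'rV[R]_(1 + 3)) *m x)) *m
   col_mx (homv x) Qstd.
  rewrite mul_row_col mul_Qstd /homv /dir mul_mx_row mulmx1 add_row_mx addr0.
  by rewrite addrC subrK hsubmxK.
exact: submxMl.
Qed.

End AffinePoints.

Section AffineTopology.
Context {R : realType}.
Implicit Types (S : set 'rV[R]_3).

Lemma dehom_continuous (w : 'rV[R]_(1 + 3)) : w 0 0 != 0 ->
  {for w, continuous (@dehom R)}.
Proof.
move=> w0; have c0 : {for w, continuous (fun u : 'rV[R]_(1 + 3) => u 0 0 : R^o)}.
  exact: (@coord_continuous R 1 (1 + 3) 0 0).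
by apply: continuousZ; [exact: continuousV|exact: mx_linear_continuous].
Qed.

Lemma chart_continuous k n (P : 'M[R]_(k, n)) m (Q : 'M[R]_(m, n)) :
  continuous (fun A : 'M[R]_(k, m) => P + A *m Q).
Proof.
move=> A.
have cQ := @mx_linear_continuous _ _ _ _ (mulmxr Q : 'M[R]_(k, m) -> 'M[R]_(k, n)).
have := @continuousD R 'M[R]_(k, n) _ (cst P) (mulmxr Q) A
  (@cst_continuous _ _ P A) (cQ A).
exact.
Qed.

Lemma near_dehom (P : 'rV[R]_(1 + 3)) (Q : 'M[R]_(3, 1 + 3)) A S : open S ->
  (P + A *m Q) 0 0 != 0 -> S (dehom (P + A *m Q)) ->
  \forall B \near A, (P + B *m Q) 0 0 != 0 /\ S (dehom (P + B *m Q)).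
Proof.
move=> oS w0 Sw; have cw := @chart_continuous _ _ P _ Q A.
have c0 : {for A, continuous (fun B : 'rV[R]_3 => (P + B *m Q) 0 0 : R^o)}.
  apply: (@continuous_comp _ _ _ (fun B : 'rV[R]_3 => P + B *m Q)
    (fun w : 'rV[R]_(1 + 3) => w 0 0 : R^o)) => //.
  exact: (@coord_continuous R 1 (1 + 3) 0 0).
have c1 : {for A, continuous (fun B : 'rV[R]_3 => dehom (P + B *m Q))}.
  exact: (continuous_comp cw (dehom_continuous w0)).
have o0 : open [set r : R^o | r != 0] by exact: open_neq.
have n0 : \forall B \near A, (P + B *m Q) 0 0 != 0 :=
  c0 _ (open_nbhs_nbhs (conj o0 w0)).
have n1 : \forall B \near A, S (dehom (P + B *m Q)) :=
  c1 _ (open_nbhs_nbhs (conj oS Sw)).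
by apply: filterS2 n0 n1 => B; split.
Qed.

Lemma open_grassE k n (S : set (Grass R k n)) : open S = grass_open S.
Proof. by []. Qed.

Lemma open_affpt S : open S -> open (affpt @` S : set (RP R 3)).
Proof.
rewrite open_grassE => oS P Q fPQ; rewrite in_chart_affpt openE => A /= [w0 Sw].
exact: near_dehom.
Qed.

(** No point at infinity is a limit of S: near it the affine coordinates are
    larger than M times the first homogeneous coordinate. *)
Lemma closed_affpt S M : closed S -> (forall x, S x -> `|x| <= M) ->
  closed (affpt @` S : set (RP R 3)).
Proof.
move=> cS bS; rewrite -openC open_grassE => P Q fPQ.
have E A : in_chart P Q (~` (affpt @` S)) A <->
    ~ in_chart P Q (affpt @` S) A.
  split=> [[V nV eV] [W SW eW]|nA].
    by apply: nV; rewrite (_ : V = W) //; apply: val_inj; rewrite eV eW.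
  have dA := dim_rowspan (frame_row_free A isT fPQ).
  exists (exist _ (rowspan (P + A *m Q)) (introT eqP dA) : RP R 3) => //.
  move=> SA; apply: nA.
  by exists (exist _ (rowspan (P + A *m Q)) (introT eqP dA) : RP R 3).
rewrite openE => A /E; rewrite in_chart_affpt => nA; rewrite /interior.
suff : \forall B \near A, ~ ((P + B *m Q) 0 0 != 0 /\ S (dehom (P + B *m Q))).
  by apply: filterS => B nB; apply/E; rewrite in_chart_affpt.
have [w0|w0] := eqVneq ((P + A *m Q : 'rV[R]_(1 + 3)) 0 0) 0; last first.
  have oS : open (~` S) by rewrite openC.
  have nS : (~` S) (dehom (P + A *m Q)) by move=> SA; exact: nA.
  by apply: filterS (near_dehom oS w0 nS) => B [_ nB] [_].
pose w (B : 'rV[R]_3) : 'rV[R]_(1 + 3) := P + B *m Q.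
have wA0 : 0 < `|rsubmx (w A)|.
  rewrite normr_gt0; apply/eqP => r0.
  have := frame_row_free A isT fPQ; rewrite -[_ + _]/(w A).
  have -> : w A = 0.
    by rewrite -[LHS]hsubmxK r0 lsubmx_rV1 [w A 0 0]w0 raddf0 row_mx0.
  by rewrite /row_free mxrank0.
have cw := @chart_continuous _ _ P _ Q A.
have cr : {for A, continuous (fun B => `|rsubmx (w B)| - M * `|w B 0 0| : R^o)}.
  apply: (@continuousB R R^o).
    apply: (@continuous_comp _ _ _ w (fun u : 'rV[R]_(1 + 3) => `|rsubmx u| : R^o)) => //.
    apply: (@continuous_comp _ _ _ (@rsubmx R 1 1 3) (fun u : 'rV[R]_3 => `|u| : R^o)).
      exact: mx_linear_continuous.
    exact: norm_continuous.
  apply: continuousM; first exact: cst_continuous.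
  apply: (@continuous_comp _ _ _ w (fun u : 'rV[R]_(1 + 3) => `|u 0 0| : R^o)) => //.
  apply: (@continuous_comp _ _ _ (fun u : 'rV[R]_(1 + 3) => u 0 0 : R^o)
    (fun u : R^o => `|u|)).
    exact: (@coord_continuous R 1 (1 + 3) 0 0).
  exact: norm_continuous.
have gA : 0 < `|rsubmx (w A)| - M * `|w A 0 0|.
  by rewrite [w A 0 0]w0 normr0 mulr0 subr0.
have o0 : open [set r : R^o | 0 < r] by exact: open_gt.
have : \forall B \near A, 0 < `|rsubmx (w B)| - M * `|w B 0 0| :=
  cr _ (open_nbhs_nbhs (conj o0 gA)).
apply: filterS => B; rewrite subr_gt0 => lt [wB0 /bS].
rewrite /dehom normrZ normfV ler_pdivrMl ?normr_gt0 // mulrC.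
by move=> /(lt_le_trans lt); rewrite ltxx.
Qed.

Lemma closure_affpt S M : (forall x, S x -> `|x| <= M) ->
  closure (affpt @` S : set (RP R 3)) = affpt @` closure S.
Proof.
move=> bS; apply/seteqP; split.
  rewrite closureE; apply: bigcap_inf; split.
    apply: (@closed_affpt _ M); first exact: closed_closure.
    have cM : closed [set x : 'rV[R]_3 | `|x| <= M].
      have /continuous_closedP cn := @norm_continuous _ 'rV[R]_3.
      by apply: (cn [set r | r <= M]); exact: closed_le.
    by move=> x; rewrite closureE => /(_ _ (conj cM bS)).
  by move=> _ [x Sx <-]; exists x => //; exact: subset_closure.
move=> _ [x cx <-]; move=> B'; rewrite nbhsE => -[B [+ Bx] sB].
rewrite open_grassE => /(_ _ _ (frame_std x)) oBx.
have BA : in_chart (homv x) Qstd B 0 by exists (affpt x) => //; rewrite mul0mx addr0.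
have cf : {for x, continuous (fun y : 'rV[R]_3 => y - x)}.
  by apply: (@continuousB R 'rV[R]_3) => //; exact: cst_continuous.
have x0 : in_chart (homv x) Qstd B (x - x) by rewrite subrr.
have nB : \forall y \near x, in_chart (homv x) Qstd B (y - x) :=
  cf _ (open_nbhs_nbhs (conj oBx x0)).
have [y [Sy [V BV eV]]] := cx _ nB.
exists (affpt y); split; [by exists y|apply: sB].
rewrite (_ : affpt y = V) //; apply: val_inj; rewrite eV.
by rewrite mul_Qstd -homvD addrC subrK.
Qed.

End AffineTopology.

(** * Ovals: zero sets of strictly convex functions *)

Section Ovals.
Context {R : realType}.

(** [oval_convex] is strict convexity in first-order form: the graph of f is
    above its tangent hyperplanes. *)
Record oval_equation (f : 'rV[R]_3 -> R^o) : Prop := OvalEquation {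
  oval_smooth : smooth_on setT f;
  oval_convex : forall x y, x != y -> f x + 'D_(y - x) f x < f y;
  oval_inhabited : exists x, f x < 0;
  oval_bounded : exists M, forall x, f x <= 0 -> `|x| <= M }.

Definition oval (f : 'rV[R]_3 -> R^o) : set (RP R 3) :=
  affpt @` [set x | f x = 0].

Variable (f : 'rV[R]_3 -> R^o).
Hypothesis of_ : oval_equation f.

Lemma oval_diff x : differentiable f x.
Proof. exact: Ck_differentiable (oval_smooth of_ 1). Qed.

Lemma oval_cts : continuous f.
Proof. by move=> x; apply: differentiable_continuous; exact: oval_diff. Qed.

Lemma oval_lt x y (t : R) : x != y -> 0 < t < 1 ->
  f ((1 - t) *: x + t *: y) < (1 - t) * f x + t * f y.
Proof.
move=> xy /andP[t0 t1]; set z := _ + _.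
have zx : x - z = t *: (x - y).
  by apply/rowP => i; rewrite !mxE; ring.
have zy : y - z = (1 - t) *: (y - x).
  by apply/rowP => i; rewrite !mxE; ring.
have nx : z != x.
  by rewrite eq_sym -subr_eq0 zx scaler_eq0 negb_or gt_eqF //= subr_eq0.
have ny : z != y.
  by rewrite eq_sym -subr_eq0 zy scaler_eq0 negb_or gt_eqF ?subr_gt0 //= subr_eq0 eq_sym.
have := oval_convex of_ ny; have := oval_convex of_ nx.
rewrite zx zy !deriveE; do ?exact: oval_diff.
rewrite !linearZ /= -![_ *: _]/(_ * _) -[y - x]opprB linearN /=.
set d := 'd _ _ _ => h1 h2.
nra.
Qed.

Lemma oval_deriv_neq0 x : f x = 0 -> exists h, 'd f x h != 0.
Proof.
move=> fx; have [y fy] := oval_inhabited of_.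
have xy : x != y by apply: contraTneq fy => <-; rewrite fx ltxx.
have := oval_convex of_ xy; rewrite fx add0r deriveE; last exact: oval_diff.
by move=> lt; exists (y - x); rewrite lt_eqF //; exact: lt_trans lt fy.
Qed.

Lemma oval_closure : closure [set x | f x < 0] = [set x | f x <= 0].
Proof.
apply/seteqP; split=> x.
  rewrite closureE => /(_ [set x | f x <= 0]); apply; split.
    have /continuous_closedP cf := oval_cts.
    by apply: (cf [set r | r <= 0]); exact: closed_le.
  by move=> y /=; exact: ltW.
move=> /= fx; have [y fy] := oval_inhabited of_.
have [<-|xy] := eqVneq y x; first exact: subset_closure.
move=> B nB; pose g (t : R^o) : 'rV[R]_3 := (1 - t) *: x + t *: y.
have g0 : g 0 = x by rewrite /g subr0 scale1r scale0r addr0.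
have cg : {for 0, continuous g}.
  apply: (@continuousD R 'rV[R]_3); apply: continuousZr_tmp.
    by apply: (@continuousB R R^o); [exact: cst_continuous|exact: cvg_id].
  exact: cvg_id.
have nB' : nbhs (g 0) B by rewrite g0.
have /nbhs_ballP[e /= e0 eB] : \forall t \near (0 : R^o), B (g t) := cg _ nB'.
pose t : R := Num.min (e / 2) (1 / 2).
have t0 : 0 < t by rewrite lt_min divr_gt0 //=.
have te : t < e by rewrite gt_min; apply/orP; left; lra.
have t1 : t < 1 by rewrite gt_min; apply/orP; right; lra.
exists (g t); split.
  have := @oval_lt x y t; rewrite eq_sym xy t0 t1 => /(_ isT isT) lt.
  by rewrite /=; apply: lt_trans lt _; nra.
by apply: eB; rewrite -ball_normE /= sub0r normrN gtr0_norm.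
Qed.

Lemma oval_chart x : in_chart (homv x) Qstd (oval f) = [set A | f (x + A) = 0].
Proof. exact: in_chart_std. Qed.

Definition oval_tangent x : {vspace 'M[R]_(1, 3 - 0)} :=
  lker (linfun ('d f x : {linear 'rV[R]_3 -> R^o})).

Lemma oval_has_tangent_space x : f x = 0 ->
  has_tangent_space (homv x : 'M[R]_(0.+1, 3.+1)) Qstd 1 (oval f) (oval_tangent x).
Proof.
move=> fx; exists setT, (fun _ A => f (x + A)); split.
- by split=> //; exact: openT.
- by move=> _ k; apply: Ck_shiftl; exact: oval_smooth.
- rewrite oval_chart /= addr0; split=> // A _; split=> [//|/(_ 0)//].
- move=> v; rewrite memv_ker lfunE /=.
  have dE : 'd (fun A => f (x + A)) 0 v = 'd f x v.
    have := @diff_shiftl _ _ f x 0 v (oval_diff (x + 0)).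
    by rewrite addr0.
  split=> [/eqP e _|/(_ ord0) e]; first exact: (etrans dE e).
  by apply/eqP; exact: (etrans (esym dE) e).
- by have [h dh] := oval_deriv_neq0 fx; exact: (dim_lker_functional dh).
Qed.

Lemma centered_std x : centered_frame (affpt x) (homv x : 'M[R]_(0.+1, 3.+1)) Qstd.
Proof. by split; first exact: frame_std. Qed.

Lemma oval_smooth_hypersurface : smooth_hypersurface (oval f).
Proof.
move=> _ [x fx <-]; exists (homv x), Qstd, (oval_tangent x).
by split; [exact: centered_std|exact: oval_has_tangent_space].
Qed.

(** The open set bounded by the oval is f < 0. It is bounded, so its closure and
    interior in projective space are those in affine space. *)
Lemma oval_convex_hypersurface : convex_hypersurface (oval f).
Proof.
split; first exact: oval_smooth_hypersurface.
pose S := [set x | f x < 0].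
have oS : open S.
  by have /continuousP cf := oval_cts; apply: (cf [set r | r < 0]); exact: open_lt.
have oC : open (affpt @` S : set (RP R 3)) by exact: open_affpt.
exists (affpt @` S); split=> //.
  exists (rowspan Qstd); split.
  - by apply: dim_rowspan; exact: Qstd_free.
  - move=> _ [x _ <-] /=; apply/negP => /subvP /(_ (homv x)).
    rewrite !mem_rowspan submx_refl => /(_ isT) /submxP[u].
    rewrite mul_Qstd => /matrixP /(_ 0 0) /eqP.
    by rewrite homv0 dir0 oner_eq0.
  - exists (homv 0), Qstd; split=> //; first exact: frame_std.
    rewrite in_chart_std; under eq_set do rewrite add0r.
    move=> a b; rewrite -/S oval_closure /= => fa fb /eqP ab t t01.
    have -> : interior S = S by apply/interior_id.
    rewrite /S /=; apply: lt_le_trans (oval_lt ab t01) _.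
    by case/andP: t01 => t0 t1; nra.
have [M bM] := oval_bounded of_.
have bS x : S x -> `|x| <= M by move=> /ltW; exact: bM.
have -> : interior (affpt @` S : set (RP R 3)) = affpt @` S by apply/interior_id.
rewrite (closure_affpt bS) oval_closure; apply/seteqP; split.
  move=> _ [x fx <-]; split; first by exists x => //=; rewrite fx.
  by case=> y fy /affpt_inj yx; move: fy; rewrite /S /= yx fx ltxx.
move=> _ [[x /= fx <-] nx]; exists x => //=; apply/eqP.
by rewrite eq_le fx /= leNgt; apply/negP => lt; apply: nx; exists x.
Qed.

End Ovals.

(** * Tangent spaces do not depend on the equation *)

Lemma perturbed_gt0 (R : realType) (s c x y : R) : 0 < s -> 0 < c ->
  `|x| <= c / 2 -> `|y - s * (c + x)| <= s * (c / 4) -> 0 < y.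
Proof.
move=> s0 c0; rewrite !ler_norml => /andP[h1 _] /andP[h2 _].
have : 0 <= s * (c / 2 + x) by apply: mulr_ge0; [exact: ltW|lra].
have : 0 < s * c by rewrite mulr_gt0.
nra.
Qed.

Section ZeroSets.
Context {R : realType} {V : normedModType R}.

(** If v is in the kernel of the differential of psi but not of that of F, then
    F has opposite signs at s (v + eta b) and s (- v + eta b) for small s and
    eta, so it vanishes somewhere on the segment between them. There psi is
    equivalent to s eta times its derivative along b, hence is not 0. *)
Lemma tangent_zero_set (F psi : V -> R^o) (b v : V) :
  continuous F -> differentiable F 0 -> F 0 = 0 ->
  differentiable psi 0 -> psi 0 = 0 ->
  (\forall y \near 0, F y = 0 -> psi y = 0) ->
  'd psi 0 b != 0 -> 'd psi 0 v = 0 -> 'd F 0 v = 0.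
Proof.
move=> cF dF F0 dpsi psi0 Fpsi psib psiv.
apply: contrapT => /eqP; wlog c0 : v psiv / 0 < 'd F 0 v => [H Fv|_].
  have [|Fv'|Fv'] := ltgtP ('d F 0 v) 0; last by rewrite Fv' eqxx in Fv.
    have eF : 'd F 0 (- v) = - 'd F 0 v by rewrite linearN.
    have ep : 'd psi 0 (- v) = 0 by rewrite linearN psiv oppr0.
    by move=> lt; apply: (H (- v) ep); rewrite eF ?oppr_gt0 ?oppr_eq0.
  exact: (H v).
set c : R := 'd F 0 v in c0; set g : R := 'd F 0 b.
(* With this eta, v + eta b and - v + eta b keep the signs of F along v and
   - v, up to a factor 1/2. *)
pose eta := c / (2 * (`|g| + 1)).
have g1 : 0 < `|g| + 1 by rewrite ltr_wpDl.
have eta0 : 0 < eta by rewrite divr_gt0 // mulr_gt0.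
have etag : eta * `|g| <= c / 2.
  have -> : c / 2 = eta * (`|g| + 1) by rewrite /eta; field; rewrite gt_eqF.
  by rewrite ler_pM2l // lerDl.
pose K := `|v| + eta * `|b| + 1.
have K0 : 0 < K by rewrite ltr_wpDl // addr_ge0 // mulr_ge0 // ltW.
pose kap := eta * 'd psi 0 b.
have kap0 : 0 < `|kap| by rewrite normr_gt0 mulf_neq0 // gt_eqF.
(* rho bounds both remainders, relative to |y|: at points of norm at most s K it
   leaves the signs of F at the ends and of psi unchanged. *)
pose rho := Num.min (c / 4) (`|kap| / 2) / K.
have rho0 : 0 < rho by rewrite divr_gt0 // lt_min !divr_gt0.
have rK : rho * K <= c / 4 /\ rho * K <= `|kap| / 2.
  by rewrite /rho divfK ?gt_eqF // !ge_min !lexx ?orbT.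
have near0 (u : V -> R^o) : differentiable u 0 -> u 0 = 0 ->
    \forall y \near 0, `|u y - 'd u 0 y| <= rho * `|y|.
  move=> du u0; apply: filterS (near_diff du rho0) => h.
  by rewrite add0r u0 subr0.
have nF := near0 _ dF F0; have npsi := near0 _ dpsi psi0.
have [d /= d0 dP] : exists2 d, 0 < d & forall y : V, `|y| < d ->
    [/\ `|F y - 'd F 0 y| <= rho * `|y|, `|psi y - 'd psi 0 y| <= rho * `|y| &
        F y = 0 -> psi y = 0].
  have /nbhs_ballP[d /= d0 dP] : \forall y \near (0 : V), [/\
    `|F y - 'd F 0 y| <= rho * `|y|, `|psi y - 'd psi 0 y| <= rho * `|y| &
        F y = 0 -> psi y = 0].
    by apply: filterS3 nF npsi Fpsi => y; split.
  by exists d => // y yd; apply: dP; rewrite -ball_normE /= sub0r normrN.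
pose s := d / (2 * K).
have s0 : 0 < s by rewrite divr_gt0 // mulr_gt0.
pose y (tau : R^o) : V := s *: (tau *: v + eta *: b).
have yK tau : -1 <= tau <= 1 -> `|y tau| <= s * K.
  move=> tau1; rewrite normrZ gtr0_norm // ler_pM2l //.
  apply: le_trans (ler_normD _ _) _; rewrite 2!normrZ (gtr0_norm eta0) /K.
  rewrite -addrA lerD ?lerDl // ler_piMl //.
  by rewrite ler_norml.
have sK : s * K < d.
  have -> : s * K = d / 2 by rewrite /s; field; rewrite gt_eqF.
  by rewrite ltr_pdivrMr // ltr_pMr // ltr1n.
have Fy tau : -1 <= tau <= 1 ->
    `|F (y tau) - s * (tau * c + eta * g)| <= s * (c / 4).
  move=> t1; have := yK _ t1 => yk.
  have [+ _ _] := dP _ (le_lt_trans yk sK).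
  have -> : 'd F 0 (y tau) = s * (tau * c + eta * g).
    by rewrite linearZ linearD !linearZ.
  move=> /le_trans; apply.
  apply: (@le_trans _ _ (rho * (s * K))); first by rewrite ler_pM2l.
  by rewrite mulrCA ler_pM2l //; case: rK.
have psiy tau : -1 <= tau <= 1 ->
    `|psi (y tau) - s * kap| <= s * (`|kap| / 2).
  move=> t1; have := yK _ t1 => yk.
  have [_ + _] := dP _ (le_lt_trans yk sK).
  have -> : 'd psi 0 (y tau) = s * kap.
    by rewrite linearZ linearD !linearZ /= psiv scaler0 add0r.
  move=> /le_trans; apply.
  apply: (@le_trans _ _ (rho * (s * K))); first by rewrite ler_pM2l.
  by rewrite mulrCA ler_pM2l //; case: rK.
have etag' : `|eta * g| <= c / 2 by rewrite normrM (gtr0_norm eta0).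
have i1 : (-1 <= (1 : R)) && ((1 : R) <= 1) by rewrite lexx ge0_cp.
have i2 : (-1 <= (-1 : R)) && ((-1 : R) <= 1) by rewrite lexx ge0_cp.
have Fp : 0 < F (y 1).
  by have := Fy 1 i1; rewrite mul1r; exact: perturbed_gt0.
have Fn : F (y (-1)) < 0.
  rewrite -oppr_gt0; apply: (perturbed_gt0 (x := - (eta * g)) s0 c0).
    by rewrite normrN.
  have -> : - F (y (-1)) - s * (c + - (eta * g)) =
    - (F (y (-1)) - s * (-1 * c + eta * g)) by ring.
  by rewrite normrN; exact: Fy.
have cy : continuous (fun tau : R^o => F (y tau) : R^o).
  move=> tau; apply: (@continuous_comp _ _ _ y F); last exact: cF.
  apply: continuousZl_tmp; apply: (@continuousD R V); last exact: cst_continuous.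
  by apply: continuousZr_tmp; exact: cvg_id.
have [|||tau tau1 Ftau] := @IVT R (fun tau => F (y tau)) (-1) 1 0.
- by rewrite ge0_cp.
- exact: continuous_subspaceT.
- by rewrite ge_min le_max (ltW Fn) (ltW Fp) orbT.
rewrite in_itv /= in tau1.
have [_ _ /(_ Ftau) py] := dP _ (le_lt_trans (yK _ tau1) sK).
have := psiy _ tau1; rewrite py sub0r normrN normrM gtr0_norm //.
by rewrite ler_pM2l // ler_pdivlMr // ger_pMr // lern1.
Qed.

End ZeroSets.

(** * Changing charts of projective space *)

Section Transition.
Context {R : realType}.
Variables (x : 'rV[R]_3) (P : 'M[R]_(1, 1 + 3)) (Q : 'M[R]_(3, 1 + 3)).
Hypothesis fPQ : row_full (col_mx P Q).
Hypothesis Px : rowspan P = rowspan (homv x) :> {vspace 'rV[R]_4}.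

Let L : 'M[R]_(3, 1 + 3) := Qstd *m pinvmx (col_mx P Q).

Definition chart_lin : 'M[R]_3 := rsubmx L.
Definition chart_den (y : 'rV[R]_3) : R^o := (P 0 0)^-1 + (y *m lsubmx L) 0 0.
(** The coordinate, in the chart of the frame (P, Q), of the affine point x + y.
    This transition map is the quotient of the linear map [chart_lin] by the
    affine function [chart_den]. *)
Definition chart_map (y : 'rV[R]_3) : 'rV[R]_3 := (chart_den y)^-1 *: (y *m chart_lin).

Lemma chart_P00 : P 0 0 != 0.
Proof. by have /rowspan_homv[] := Px. Qed.

Lemma chart_PE : P = P 0 0 *: homv x.
Proof. by have /rowspan_homv[p0 ->] := Px; exact: homv_dehom. Qed.

Lemma chart_decomp y : homv (x + y) = chart_den y *: P + (y *m chart_lin) *m Q.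
Proof.
have E : dir y = row_mx (y *m lsubmx L) (y *m chart_lin) *m col_mx P Q.
  rewrite -mul_mx_row hsubmxK mulmxA mulmxKpV ?mul_Qstd //.
  by rewrite submx_full.
rewrite homvD E mul_row_col /chart_den scalerDl addrA; congr (_ + _ + _).
  by rewrite {2}chart_PE scalerA mulVf ?scale1r // chart_P00.
by rewrite {1}(mx11_scalar (y *m lsubmx L)) mul_scalar_mx.
Qed.

Lemma chart_den0 : chart_den 0 != 0.
Proof. by rewrite /chart_den mul0mx mxE addr0 invr_eq0 chart_P00. Qed.

Lemma chart_map0 : chart_map 0 = 0.
Proof. by rewrite /chart_map mul0mx scaler0. Qed.

Lemma chart_den_cts : continuous chart_den.
Proof.
move=> y; have c : {for y, continuous (fun y : 'rV[R]_3 => (y *m lsubmx L) 0 0 : R^o)}.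
  apply: (@continuous_comp _ _ _ (mulmxr (lsubmx L)) (fun u : 'M[R]_1 => u 0 0 : R^o)).
    exact: mx_linear_continuous.
  exact: (@coord_continuous R 1 1 0 0).
exact: (continuousD (@cst_continuous _ _ ((P 0 0)^-1 : R^o) y) c).
Qed.

Lemma near_chart_den : \forall y \near (0 : 'rV[R]_3), chart_den y != 0.
Proof.
have o0 : open [set r : R^o | r != 0] by exact: open_neq.
exact: (@chart_den_cts 0 _ (open_nbhs_nbhs (conj o0 chart_den0))).
Qed.

Lemma rowspan_chart y : chart_den y != 0 ->
  rowspan (homv (x + y)) = rowspan (P + chart_map y *m Q) :> {vspace 'rV[R]_4}.
Proof.
move=> d0; apply/rowspanP.
rewrite chart_decomp (_ : _ + _ = chart_den y *: (P + chart_map y *m Q)).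
  exact: eqmx_scale.
by rewrite scalerDr /chart_map -scalemxAl scalerA divff // scale1r.
Qed.

Lemma chart_lin_surj (a : 'rV[R]_3) : exists y, y *m chart_lin = a.
Proof.
pose w := a *m Q; pose y := rsubmx w - w 0 0 *: x; exists y.
have w00 := lsubmx_rV1 w.
have E : dir y = - (w 0 0 / P 0 0) *: P + a *m Q.
  rewrite {2}chart_PE scalerA -/w mulNr divfK ?chart_P00 // /homv /dir.
  rewrite scale_row_mx -[X in _ + X](hsubmxK w) add_row_mx w00; congr row_mx.
    by rewrite scaleNr scalemx1 addNr.
  by rewrite scaleNr addrC.
have F : dir y = row_mx (- (w 0 0 / P 0 0))%:M a *m col_mx P Q.
  by rewrite mul_row_col mul_scalar_mx.
have G : (y *m L) *m col_mx P Q = dir y.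
  by rewrite /L mulmxA mulmxKpV ?mul_Qstd // submx_full.
have /row_free_inj inj : row_free (col_mx P Q) by rewrite /row_free (eqP fPQ).
have /inj : (y *m L) *m col_mx P Q = row_mx (- (w 0 0 / P 0 0))%:M a *m col_mx P Q.
  by rewrite G.
rewrite /chart_lin => H; rewrite -[RHS](row_mxKr (- (w 0 0 / P 0 0))%:M a) -H.
by rewrite -[L in LHS]hsubmxK row_mxKr -[L in RHS]hsubmxK mul_mx_row row_mxKr.
Qed.

(** The numerator vanishes at 0, so the denominator contributes only its value
    there. *)
Lemma chart_map_diff : is_diff (0 : 'rV[R]_3) chart_map
  (fun y => (chart_den 0)^-1 *: (y *m chart_lin)).
Proof.
have dl : differentiable (mulmxr chart_lin : 'rV[R]_3 -> 'rV[R]_3) 0.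
  by apply: linear_differentiable; exact: mx_linear_continuous.
have cd : {for 0, continuous (fun y => (chart_den y)^-1 : R^o)}.
  by apply: continuousV; [exact: chart_den0|exact: chart_den_cts].
have m0 : mulmxr chart_lin (0 : 'rV[R]_3) = 0 by rewrite /= mul0mx.
have [d e] := is_diff_vanishZ m0 dl cd.
apply: DiffDef => //; rewrite [LHS]e; apply: funext => y.
by rewrite diff_lin //; exact: mx_linear_continuous.
Qed.

End Transition.

(** * Lines tangent to an oval *)

Section Lines.
Context {R : realType}.
Implicit Types (x y v : 'rV[R]_3).

Definition line_mx x v : 'M[R]_(1 + 1, 1 + 3) := col_mx (homv x) (dir v).

Lemma mem_line (x v : 'rV[R]_3) (w : 'rV[R]_(1 + 3)) :
  (w <= line_mx x v)%MS <-> exists a b, w = a *: homv x + b *: dir v.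
Proof.
split=> [/submxP[u ->]|[a [b ->]]].
  by exists (u 0 0), (u 0 1); exact: mul_rV2_col_mx.
apply/submxP; exists (row_mx a%:M b%:M).
by rewrite /line_mx mul_row_col !mul_scalar_mx.
Qed.

Lemma homv_line (x v y : 'rV[R]_3) :
  (homv y <= line_mx x v)%MS <-> exists t, y = x + t *: v.
Proof.
split=> [/mem_line[a [b E]]|[t ->]].
  have a1 : a = 1.
    have := congr1 (fun w : 'rV[R]_(1 + 3) => w 0 0) E.
    rewrite homv0 mxE [X in _ = X + _]mxE [X in _ = _ + X]mxE homv0 dir0.
    by rewrite mulr1 mulr0 addr0.
  exists b; apply: homv_inj.
  by rewrite E a1 scale1r homvD dirZ.
by apply/mem_line; exists 1, t; rewrite scale1r homvD dirZ.
Qed.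

Lemma dir_line (x v u : 'rV[R]_3) :
  (dir u <= line_mx x v)%MS <-> exists t, u = t *: v.
Proof.
split=> [/mem_line[a [b E]]|[t ->]].
  have a0 : a = 0.
    have := congr1 (fun w : 'rV[R]_(1 + 3) => w 0 0) E.
    rewrite dir0 mxE [X in _ = X + _]mxE [X in _ = _ + X]mxE homv0 dir0.
    by rewrite mulr1 mulr0 addr0.
  exists b; apply: dir_inj.
  by rewrite E a0 scale0r add0r dirZ.
by apply/mem_line; exists 0, t; rewrite scale0r add0r dirZ.
Qed.

Lemma line_free (x v : 'rV[R]_3) : v != 0 -> row_free (line_mx x v).
Proof.
move=> v0; apply: inj_row_free => w; rewrite mul_rV2_col_mx => E.
have a0 : w 0 0 = 0.
  have := congr1 (fun w : 'rV[R]_(1 + 3) => w 0 0) E.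
  by rewrite mxE [X in X + _]mxE [X in _ + X]mxE homv0 dir0 mulr1 mulr0 addr0 [RHS]mxE.
have b0 : w 0 1 = 0.
  move: E; rewrite a0 scale0r add0r -dirZ => E.
  have /eqP : w 0 1 *: v = 0 by apply: dir_inj; rewrite E /dir row_mx0.
  by rewrite scaler_eq0 (negPf v0) orbF => /eqP.
apply/rowP => i; rewrite [RHS]mxE.
by case: i => -[|[|//]] H; [rewrite -[RHS]a0|rewrite -[RHS]b0];
  congr (w _ _); exact: val_inj.
Qed.

Lemma line_subproof x v : v != 0 ->
  \dim (rowspan (line_mx x v) : {vspace 'rV[R]_3.+1}) == 2.
Proof. by move=> v0; rewrite dim_rowspan // line_free. Qed.

Definition line x v (v0 : v != 0) : Grass R 1 3 :=
  exist _ (rowspan (line_mx x v)) (line_subproof x v0).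

(** Lambda is not contained in the line of [homv x]; the part at infinity of any
    other vector of Lambda gives v. *)
Lemma points_of_line (Lam : Grass R 1 3) x : points_of Lam (affpt x) ->
  exists2 v, v != 0 & val Lam = rowspan (line_mx x v).
Proof.
rewrite /points_of /= => sub; have /eqP dL := valP Lam.
have [u uL nu] : exists2 u, u \in val Lam &
    u \notin (rowspan (homv x) : {vspace 'rV[R]_4}).
  apply: contrapT => H; suff /dimvS : (val Lam <= rowspan (homv x))%VS.
    by rewrite dL dim_rowspan // homv_free.
  by apply/subvP => u uL; apply: contrapT => /negP nu; apply: H; exists u.
pose u' : 'rV[R]_(1 + 3) := u; pose v := rsubmx u' - u' 0 0 *: x.
have uE : u' = u' 0 0 *: homv x + dir v.
  rewrite -[LHS]hsubmxK lsubmx_rV1 /homv /dir scale_row_mx add_row_mx addr0 scalemx1.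
  by rewrite /v addrC subrK.
have xL : homv x \in val Lam by apply: (subvP sub); rewrite mem_rowspan.
have vL : dir v \in val Lam.
  have -> : dir v = u' - u' 0 0 *: homv x by rewrite {1}uE addrC addKr.
  by rewrite memvB // memvZ.
have v0 : v != 0.
  apply: contraNneq nu => v0; rewrite mem_rowspan -[u]/u' uE v0.
  by rewrite /dir row_mx0 addr0 scalemx_sub.
exists v => //; apply/esym/eqP; rewrite eqEdim dL dim_rowspan ?line_free // andbT.
apply/subvP => w; rewrite mem_rowspan => /mem_line[a [b ->]].
by rewrite memvD // memvZ.
Qed.

End Lines.

Section LineTangentSpace.
Context {R : realType}.
Variables (x v : 'rV[R]_3) (j : 'I_3).
Hypothesis vj : v 0 j != 0.

(** The 2 x 2 minors of the rows A and v that contain the column j. When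
    v 0 j is not 0, their common zeros are the multiples of v. *)
Definition line_eq (k : 'I_2) (A : 'rV[R]_3) : R^o :=
  A 0 (lift j k) * v 0 j - A 0 j * v 0 (lift j k).

Lemma line_eq_linear k : linear (line_eq k).
Proof. by move=> a A B; rewrite /line_eq !mxE -[_ *: _]/(_ * _); ring. Qed.

HB.instance Definition _ k :=
  GRing.isLinear.Build R 'rV[R]_3 R^o _ (line_eq k) (line_eq_linear k).

Lemma line_eqP A : (forall k, line_eq k A = 0) <-> A \in <[v]>%VS.
Proof.
split=> [E|/vlineP[a ->] k]; last by rewrite /line_eq !mxE; ring.
apply/vlineP; exists (A 0 j / v 0 j); apply/rowP => i; rewrite mxE.
have [k ->|->] := unliftP j i; last by rewrite divfK.
have := E k; rewrite /line_eq => /eqP; rewrite subr_eq0 => /eqP h.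
by apply: (mulIf vj); rewrite h; field.
Qed.

Lemma line_has_tangent_space (Lam : Grass R 1 3) :
  val Lam = rowspan (line_mx x v) ->
  has_tangent_space (homv x : 'M[R]_(0.+1, 3.+1)) Qstd (3 - 1) (points_of Lam)
    (<[v]>%VS : {vspace 'M[R]_(1, 3 - 0)}).
Proof.
move=> eL.
have C (A : 'rV[R]_3) : in_chart (homv x : 'M[R]_(0.+1, 3.+1)) Qstd (points_of Lam) A <->
    A \in <[v]>%VS.
  have E : (rowspan (homv (x + A)) <= val Lam)%VS <-> A \in <[v]>%VS.
    rewrite eL rowspan_sub; split.
      by move=> /homv_line[t /addrI ->]; rewrite memvZ // memv_line.
    by move=> /vlineP[t ->]; apply/homv_line; exists t.
  split=> [[V VL]|AL].
    rewrite mul_Qstd -homvD => eV; apply/E; rewrite -eV; exact: VL.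
  exists (affpt (x + A)); first exact/E.
  by rewrite /= mul_Qstd -homvD.
exists setT, line_eq; split.
- by split=> //; exact: openT.
- by move=> k n; apply: Ck_linear; exact: mx_linear_continuous.
- split; first by apply/C; rewrite mem0v.
  by move=> A _; split=> [/C/line_eqP //|h]; apply/C/line_eqP.
- move=> A; have D k : 'd (line_eq k) 0 A = line_eq k A.
    by rewrite diff_lin //; exact: mx_linear_continuous.
  by split=> [/line_eqP h k|h]; [rewrite D|apply/line_eqP => k; rewrite -D].
- have v0 : v != 0 by apply: contra_neq vj => ->; rewrite mxE.
  by rewrite dim_vline v0 dimvf dim_matrix.
Qed.

End LineTangentSpace.

Section OmegaOval.
Context {R : realType}.
Variable (f : 'rV[R]_3 -> R^o).
Hypothesis of_ : oval_equation f.

Lemma Omega1_oval_line (Lam : Grass R 1 3) x v : v != 0 ->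
  val Lam = rowspan (line_mx x v) -> f x = 0 -> 'd f x v = 0 ->
  Omega1 (oval f) Lam.
Proof.
move=> v0 eL fx dv; exists (affpt x); split.
- by exists x.
- rewrite /points_of /= eL rowspan_sub; apply/homv_line.
  by exists 0; rewrite scale0r addr0.
- have [j vj] : exists j, v 0 j != 0.
    apply/existsP; rewrite -negb_forall; apply: contra v0 => /forallP h.
    by apply/eqP/rowP => i; rewrite mxE; exact/eqP.
  exists (homv x), Qstd, <[v]>%VS, (oval_tangent f x); split.
  + exact: centered_std.
  + exact: (@line_has_tangent_space _ x v j vj Lam eL).
  + exact: oval_has_tangent_space.
  + by apply/subvP => _ /vlineP[t ->]; apply: memvZ; rewrite memv_ker lfunE /= dv.
Qed.

Lemma derive_near0 (psi : 'rV[R]_3 -> R^o) (v : 'rV[R]_3) :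
  differentiable psi 0 -> (\forall h \near (0 : R), psi (h *: v) = 0) ->
  'd psi 0 v = 0.
Proof.
move=> dpsi N; have p0 : psi 0 = 0.
  by have := nbhs_singleton N; rewrite scale0r.
rewrite -deriveE // /derive; apply/lim_near_cst => //.
have : \forall h \near 0^', psi (h *: v) = 0 by apply: cvg_within N.
by apply: filterS => h e; rewrite /= addr0 e p0 subrr scaler0.
Qed.

Section Pullback.
Variables (x : 'rV[R]_3) (P : 'M[R]_(1, 1 + 3)) (Q : 'M[R]_(3, 1 + 3)).
Hypothesis fPQ : row_full (col_mx P Q).
Hypothesis Px : rowspan P = rowspan (homv x) :> {vspace 'rV[R]_4}.
Variables (U : set 'rV[R]_3).
Hypotheses (oU : open U) (U0 : U 0).

(** Brings an equation phi, given in an arbitrary chart centred at x, back to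
    the affine chart. *)
Lemma pullback_diff (phi : 'rV[R]_3 -> R^o) : smooth_on U phi ->
  differentiable (phi \o chart_map P Q) 0 /\
  forall y, 'd (phi \o chart_map P Q) 0 y =
    'd phi 0 ((chart_den P Q 0)^-1 *: (y *m chart_lin P Q)).
Proof.
move=> sphi; have [dc ec] := chart_map_diff Q Px.
have dphi : differentiable phi (chart_map P Q 0).
  by rewrite chart_map0; have [+ _] := sphi 1%N; apply.
split; first exact: differentiable_comp.
move=> y; rewrite (diff_comp dc dphi) /= chart_map0.
by congr ('d phi 0 _); rewrite -[RHS]/((fun y => _) y) -ec.
Qed.

Lemma near_pullback : \forall y \near (0 : 'rV[R]_3),
  chart_den P Q y != 0 /\ U (chart_map P Q y).
Proof.
have [dc _] := chart_map_diff Q Px.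
have cc := differentiable_continuous dc.
have U0' : U (chart_map P Q 0) by rewrite chart_map0.
have n1 : \forall y \near (0 : 'rV[R]_3), U (chart_map P Q y) :=
  cc _ (open_nbhs_nbhs (conj oU U0')).
by apply: filterS2 (near_chart_den Q Px) n1 => y; split.
Qed.

Lemma in_chart_map (S : set (RP R 3)) y : chart_den P Q y != 0 ->
  S (affpt (x + y)) -> in_chart P Q S (chart_map P Q y).
Proof. by move=> d0 Sy; exists (affpt (x + y)) => //; exact: rowspan_chart. Qed.

End Pullback.

(** The charts and equations that witness tangency are arbitrary. Pulled back to
    the affine chart, the equations of the line vanish along v, which puts v in
    the tangent space of the oval; [tangent_zero_set] then compares the
    equation of the oval with f. *)
Lemma Omega1_ovalP (Lam : Grass R 1 3) : Omega1 (oval f) Lam <->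
  exists x v, [/\ v != 0, val Lam = rowspan (line_mx x v), f x = 0 &
                  'd f x v = 0].
Proof.
split=> [[_ [[x /= fx <-] xL [P [Q [TL [TX [[fPQ Px] hL hX sub]]]]]]]|]; last first.
  by move=> [x [v [v0 eL fx dv]]]; exact: Omega1_oval_line eL fx dv.
have [v v0 eL] := points_of_line xL; exists x, v; split=> //.
have [UL [phiL [[oUL UL0] sL [_ zL] kL dL]]] := hL.
have [UX [phiX [[oUX UX0] sX [cX zX] kX dX]]] := hX.
have vTL : (chart_den P Q 0)^-1 *: (v *m chart_lin P Q) \in TL.
  apply/kL => i.
  have [dpsi <-] := pullback_diff Q Px UL0 (sL i).
  apply: derive_near0 => //.
  have cv : {for 0, continuous (fun h : R^o => h *: v)}.
    by apply: continuousZr_tmp; exact: cvg_id.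
  have n0 : nbhs ((0 : R^o) *: v)
      [set y | chart_den P Q y != 0 /\ UL (chart_map P Q y)].
    by rewrite scale0r; exact: (near_pullback Q Px oUL UL0).
  have nh : \forall h \near (0 : R), chart_den P Q (h *: v) != 0 /\
    UL (chart_map P Q (h *: v)) := cv _ n0.
  apply: filterS nh => h [d0 Uh] /=.
  apply: (zL _ Uh).1; apply: (in_chart_map fPQ Px) => //.
  by rewrite /points_of /= eL rowspan_sub; apply/homv_line; exists h.
have vTX := subvP sub _ vTL.
have [dpsi psiE] := pullback_diff Q Px UX0 (sX ord0).
have psi0 : (phiX ord0 \o chart_map P Q) 0 = 0.
  rewrite /= chart_map0; exact: (zX _ UX0).1 cX ord0.
have [a na] : exists a : 'rV[R]_3, 'd (phiX ord0) 0 a != 0.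
  apply: contrapT => H; suff TX1 : TX = fullv.
    by move: dX; rewrite TX1 addn1 => /eqP; rewrite gtn_eqF.
  apply/vspaceP => a; rewrite memvf; apply/kX => i; rewrite ord1.
  by apply: contrapT => /eqP na; apply: H; exists a.
have [b bE] := chart_lin_surj fPQ Px (chart_den P Q 0 *: a).
have := @diff_shiftl _ _ f x 0 v (oval_diff of_ (x + 0)).
rewrite addr0 => <-.
apply: (@tangent_zero_set _ _ (fun y => f (x + y)) (phiX ord0 \o chart_map P Q) b) => //.
- move=> y; apply: differentiable_continuous; apply: differentiable_shiftl.
  exact: oval_diff.
- by apply: differentiable_shiftl; exact: oval_diff.
- by rewrite addr0.
- apply: filterS (near_pullback Q Px oUX UX0) => y [d0 Uy] fy.
  by apply: (zX _ Uy).1; apply: (in_chart_map fPQ Px) => //; exists (x + y).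
- by rewrite psiE bE scalerA (mulVf (chart_den0 Q Px)) scale1r.
- by rewrite psiE; exact: (kX _).1 vTX ord0.
Qed.

End OmegaOval.

(** * The tangent lines of an oval in a chart of the Grassmannian *)

Lemma mul_Qstd2 (R : realType) (B : 'M[R]_(1 + 1, 3)) :
  B *m Qstd = col_mx (dir (usubmx B)) (dir (dsubmx B)).
Proof. by rewrite -{1}[B]vsubmxK mul_col_mx !mul_Qstd. Qed.

Lemma line_slide (R : realType) (x v : 'rV[R]_3) s :
  rowspan (line_mx (x + s *: v) v) = rowspan (line_mx x v) :> {vspace 'rV[R]_4}.
Proof.
have sub (y : 'rV[R]_3) r : (line_mx (y + r *: v) v <= line_mx y v)%MS.
  rewrite {1}/line_mx col_mx_sub; apply/andP; split.
    by apply/homv_line; exists r.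
  by apply/dir_line; exists 1; rewrite scale1r.
apply/rowspanP/eqmxP; rewrite sub /=.
by have := sub (x + s *: v) (- s); rewrite scaleNr addrK.
Qed.

Section LineChart.
Context {R : realType}.
Variables (p v : 'rV[R]_3) (E : 'M[R]_(2, 3)).
Hypothesis basis : row_full (col_mx v E).

(** In the chart of the frame (line_mx p v, E *m Qstd), the matrix A is the
    coordinate of the line through [base A] directed by [direction A]. *)
Definition base (A : 'M[R]_2) : 'rV[R]_3 := p + usubmx (A *m E : 'M[R]_(1 + 1, 3)).
Definition direction (A : 'M[R]_2) : 'rV[R]_3 := v + dsubmx (A *m E : 'M[R]_(1 + 1, 3)).

Lemma base0 : base 0 = p.
Proof. by rewrite /base mul0mx linear0 addr0. Qed.
Lemma direction0 : direction 0 = v.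
Proof. by rewrite /direction mul0mx linear0 addr0. Qed.

Lemma line_chartE (A : 'M[R]_2) :
  line_mx p v + A *m (E *m Qstd) = line_mx (base A) (direction A).
Proof.
rewrite mulmxA (mul_Qstd2 (A *m E)) /line_mx.
by rewrite add_col_mx -homvD -dirD.
Qed.

Lemma direction_neq0 A : direction A != 0.
Proof.
have /row_free_inj inj : row_free (col_mx v E) by rewrite /row_free (eqP basis).
apply/eqP => d0.
pose w := dsubmx (A : 'M[R]_(1 + 1, 2)).
have : row_mx 1%:M w *m col_mx v E = 0 *m col_mx v E.
  rewrite mul0mx mul_row_col mul1mx /w -[RHS]d0; congr (_ + _).
  by rewrite mul_dsub_mx.
move=> /inj; rewrite -(row_mx0 _ 1 1 2) => /eq_row_mx[/matrixP/(_ 0 0)].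
by rewrite !mxE eqxx => /eqP; rewrite oner_eq0.
Qed.

Lemma line_frame :
  frame (line_mx p v : 'M[R]_(1.+1, 3.+1)) (E *m Qstd : 'M[R]_(3 - 1, 4)).
Proof.
rewrite /frame -sub1mx; apply/rV_subP => u _.
pose u' : 'rV[R]_(1 + 3) := u.
pose z := rsubmx u' - lsubmx u' *m p.
have /submxP[w wz] : (z <= col_mx v E)%MS by rewrite submx_full.
have -> : u = row_mx (row_mx (lsubmx u') (lsubmx (w : 'rV[R]_(1 + 2))))
    (rsubmx (w : 'rV[R]_(1 + 2))) *m col_mx (line_mx p v) (E *m Qstd).
  rewrite !mul_row_col mulmxA mul_Qstd -addrA.
  have -> : lsubmx (w : 'rV[R]_(1 + 2)) *m dir v =
      dir (lsubmx (w : 'rV[R]_(1 + 2)) *m v).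
    by rewrite /dir mul_mx_row mulmx0.
  rewrite -dirD -mul_row_col hsubmxK -wz /homv mul_mx_row mulmx1 /dir.
  rewrite add_row_mx addr0.
  by rewrite /z addrC subrK hsubmxK.
exact: submxMl.
Qed.

Section Oval.
Variables (f : 'rV[R]_3 -> R^o) (tau : 'M[R]_2 -> R^o).
Hypothesis of_ : oval_equation f.
Hypothesis critical : forall A,
  'd f (base A + tau A *: direction A) (direction A) = 0.
Hypothesis smooth_tau : smooth_on setT tau.

(** The point where f is minimal on the line of coordinate A, and the minimum:
    the line is tangent to the oval when the latter is 0. *)
Definition contact (A : 'M[R]_2) : 'rV[R]_3 := base A + tau A *: direction A.
Definition depth (A : 'M[R]_2) : R^o := f (contact A).
Hypothesis smooth_depth : smooth_on setT depth.

(** Of two critical points of f on a line, each would have a smaller value than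
    the other by strict convexity. *)
Lemma contact_unique A s :
  'd f (base A + s *: direction A) (direction A) = 0 -> s = tau A.
Proof.
move=> ds; apply: contrapT => /eqP st.
pose x := base A + s *: direction A; pose y := contact A.
have yx : y - x = (tau A - s) *: direction A.
  by rewrite /y /contact /x opprD addrACA subrr add0r -scalerBl.
have xy : x != y.
  by rewrite eq_sym -subr_eq0 yx scaler_eq0 negb_or direction_neq0 subr_eq0 eq_sym st.
have yx' : y != x by rewrite eq_sym.
have dx : 'd f x (direction A) = 0 := ds.
have dy : 'd f y (direction A) = 0 := critical A.
have Lx : 'D_(y - x) f x = 0.
  by rewrite (deriveE _ (oval_diff of_ x)) yx linearZ /= dx scaler0.
have Ly : 'D_(x - y) f y = 0.
  by rewrite (deriveE _ (oval_diff of_ y)) -opprB yx -scaleNr linearZ /= dy scaler0.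
have := oval_convex of_ xy; rewrite Lx addr0 => h1.
have := oval_convex of_ yx'; rewrite Ly addr0 => h2.
by have := lt_trans h1 h2; rewrite ltxx.
Qed.

Lemma Omega1_chart A :
  in_chart (line_mx p v : 'M[R]_(1.+1, 3.+1)) (E *m Qstd : 'M[R]_(3 - 1, 4))
    (Omega1 (oval f)) A <-> depth A = 0.
Proof.
have LE : rowspan (line_mx p v + A *m (E *m Qstd)) =
    rowspan (line_mx (base A) (direction A)) :> {vspace 'rV[R]_4}.
  by rewrite line_chartE.
split=> [[V /(Omega1_ovalP of_)[x [u [u0 eV fx dx]]] eA]|d0].
  have /rowspanP eqL : rowspan (line_mx x u) = rowspan (line_mx (base A) (direction A))
    :> {vspace 'rV[R]_4} := etrans (esym eV) (etrans eA LE).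
  have /homv_line[s xs] : (homv x <= line_mx (base A) (direction A))%MS.
    by rewrite -eqL; apply/homv_line; exists 0; rewrite scale0r addr0.
  have /dir_line[k dk] : (dir (direction A) <= line_mx x u)%MS.
    by rewrite eqL; apply/dir_line; exists 1; rewrite scale1r.
  have st : s = tau A.
    by apply: contact_unique; rewrite -xs dk linearZ /= dx scaler0.
  by rewrite /depth /contact -st -xs.
exists (line (base A) (direction_neq0 A)); last exact: (esym LE).
apply/(Omega1_ovalP of_); exists (contact A), (direction A); split.
- exact: direction_neq0.
- by rewrite /= line_slide.
- exact: d0.
- exact: critical.
Qed.

Lemma critical0 : 'd f (contact 0) v = 0.
Proof.
have c0 : 'd f (contact 0) (direction 0) = 0 := critical 0.
by move: c0; rewrite direction0.
Qed.

(** The contact point also slides along the line, but there f is critical: only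
    the displacement of the line at the contact point counts. *)
Lemma diff_depth B : 'd depth 0 B =
  'd f (contact 0) (usubmx (B *m E : 'M[R]_(1 + 1, 3)) +
                    tau 0 *: dsubmx (B *m E : 'M[R]_(1 + 1, 3))).
Proof.
pose U : {linear 'M[R]_2 -> 'rV[R]_3} := @usubmx R 1 1 3 \o mulmxr E.
pose D : {linear 'M[R]_2 -> 'rV[R]_3} := @dsubmx R 1 1 3 \o mulmxr E.
have cU : continuous U by exact: mx_linear_continuous.
have cD : continuous D by exact: mx_linear_continuous.
have dtau : differentiable tau 0 by exact: Ck_differentiable (smooth_tau 1).
have dU : differentiable U 0 by exact: linear_differentiable.
have dD : differentiable D 0 by exact: linear_differentiable.
have D0 : D 0 = 0 by exact: linear0.
have iU : is_diff 0 U U by apply: DiffDef => //; exact: diff_lin.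
have iD := is_diff_vanishZ D0 dD (differentiable_continuous dtau).
have itv : is_diff 0 (fun A => tau A *: v) (fun B => 'd tau 0 B *: v).
  by apply: DiffDef; [exact: differentiableZl|exact: diffZl].
have ic : is_diff 0 contact (cst 0 + U + (fun B => 'd tau 0 B *: v) +
    (fun B => tau 0 *: 'd D 0 B)).
  have -> : contact = cst p + U + (fun A => tau A *: v) + (fun A => tau A *: D A).
    by apply: funext => A; rewrite /contact /base /direction scalerDr addrA.
  exact: (is_diffD (is_diffD (is_diffD (is_diff_cst p 0) iU) itv) iD).
have [dc ec] := ic.
have df : differentiable f (contact 0) by exact: oval_diff.
have eD : 'd D 0 B = D B := congr1 (fun g => g B) (diff_lin 0 cD).
have eB : 'd contact 0 B = (U B + tau 0 *: D B) + 'd tau 0 B *: v.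
  have /= -> := congr1 (fun g => g B) ec.
  by rewrite !fctE eD add0r addrAC.
have -> : 'd depth 0 B = 'd f (contact 0) ('d contact 0 B).
  exact: (congr1 (fun g => g B) (diff_comp dc df)).
rewrite eB.
rewrite linearD linearZ /=.
by rewrite critical0 scaler0 addr0.
Qed.

Definition Omega1_tangent : {vspace 'M[R]_(2, 3 - 1)} :=
  lker (linfun ('d depth 0 : {linear 'M[R]_2 -> R^o})).

Lemma Omega1_has_tangent_space : depth 0 = 0 ->
  has_tangent_space (line_mx p v : 'M[R]_(1.+1, 3.+1))
    (E *m Qstd : 'M[R]_(3 - 1, 4)) 1 (Omega1 (oval f)) Omega1_tangent.
Proof.
move=> d0; exists setT, (fun _ => depth); split.
- by split=> //; exact: openT.
- by move=> _.
- split; first exact/Omega1_chart.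
  by move=> A _; rewrite Omega1_chart; split=> [//|/(_ ord0)].
- move=> B; rewrite memv_ker lfunE /=.
  by split=> [/eqP e _|/(_ ord0)/eqP].
- have [h dh] := oval_deriv_neq0 of_ d0.
  have /submxP[w hw] : (h <= col_mx v E)%MS by rewrite submx_full.
  pose B : 'M[R]_2 := col_mx (rsubmx (w : 'rV[R]_(1 + 2))) 0.
  apply: (@dim_lker_functional _ _ _ B).
  rewrite diff_depth /B -mul_usub_mx -mul_dsub_mx col_mxKu col_mxKd mul0mx.
  rewrite scaler0 addr0.
  apply: contra_neq dh => d; rewrite hw -(hsubmxK (w : 'rV[R]_(1 + 2))) mul_row_col.
  rewrite linearD /= d addr0 [lsubmx _]mx11_scalar mul_scalar_mx linearZ /=.
  by rewrite critical0 scaler0.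
Qed.

End Oval.
End LineChart.

(** * Corrugated spheres *)

Definition coord3 (R : realType) (i : 'I_3) (x : 'rV[R]_3) : R^o := x 0 i.
Local Notation X3 := (coord3 (@Ordinal 3 0 isT)).
Local Notation Y3 := (coord3 (@Ordinal 3 1 isT)).
Local Notation Z3 := (coord3 (@Ordinal 3 2 isT)).

Section Coordinates.
Context {R : realType}.
Implicit Types x y : 'rV[R]_3.

Lemma coord3_linear i : linear (@coord3 R i).
Proof. by move=> a x y; rewrite /coord3 !mxE. Qed.

HB.instance Definition _ i :=
  GRing.isLinear.Build R 'rV[R]_3 R^o _ (@coord3 R i) (coord3_linear i).

Definition vec3 (a b c : R) : 'rV[R]_3 := \row_i nth 0 [:: a; b; c] i.

Lemma vec3X a b c : X3 (vec3 a b c) = a. Proof. by rewrite /coord3 mxE. Qed.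
Lemma vec3Y a b c : Y3 (vec3 a b c) = b. Proof. by rewrite /coord3 mxE. Qed.
Lemma vec3Z a b c : Z3 (vec3 a b c) = c. Proof. by rewrite /coord3 mxE. Qed.
Definition vec3E := (vec3X, vec3Y, vec3Z).

Lemma coord3D i x y : coord3 i (x + y) = coord3 i x + coord3 i y.
Proof. by rewrite /coord3 mxE. Qed.
Lemma coord3Z i a x : coord3 i (a *: x) = a * coord3 i x.
Proof. by rewrite /coord3 mxE. Qed.

Lemma eq_vec3 x y : X3 x = X3 y -> Y3 x = Y3 y -> Z3 x = Z3 y -> x = y.
Proof.
move=> ex ey ez; apply/rowP => -[[|[|[|//]]] H].
- by rewrite (_ : Ordinal H = Ordinal (isT : (0 < 3)%N)) //; exact: val_inj.
- by rewrite (_ : Ordinal H = Ordinal (isT : (1 < 3)%N)) //; exact: val_inj.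
- by rewrite (_ : Ordinal H = Ordinal (isT : (2 < 3)%N)) //; exact: val_inj.
Qed.

Lemma sumsq_gt0 x : x != 0 -> 0 < X3 x * X3 x + Y3 x * Y3 x + Z3 x * Z3 x.
Proof.
move=> xn0; rewrite lt_neqAle !addr_ge0 -?expr2 ?sqr_ge0 // andbT eq_sym.
apply: contra_neq xn0 => e.
have := sqr_ge0 (X3 x); have := sqr_ge0 (Y3 x); have := sqr_ge0 (Z3 x) => z0 y0 x0.
have sq (a : R) : a ^+ 2 = 0 -> a = 0 by move/eqP; rewrite sqrf_eq0 => /eqP.
have X0 : X3 x = 0 by apply: sq; lra.
have Y0 : Y3 x = 0 by apply: sq; lra.
have Z0 : Z3 x = 0 by apply: sq; lra.
by apply: eq_vec3; rewrite ?X0 ?Y0 ?Z0 [RHS]mxE.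
Qed.

Lemma coord3_cts i : continuous (@coord3 R i).
Proof. exact: mx_linear_continuous. Qed.

Lemma is_derive_coord3 i x h : is_derive x h (coord3 i) (coord3 i h).
Proof.
have d : differentiable (coord3 i) x by apply: linear_differentiable; exact: coord3_cts.
apply: DeriveDef; first exact: diff_derivable.
by rewrite deriveE // diff_lin //; exact: coord3_cts.
Qed.

End Coordinates.

Section WavySphere.
Context {R : realType}.
Variables (c r eps N : R).

(** For eps = 0 the zero set is the sphere of squared radius r about (0, 0, c);
    eps and N are the amplitude and frequency of a corrugation along the
    x-axis. *)
Definition wavy (x : 'rV[R]_3) : R^o :=
  X3 x * X3 x + Y3 x * Y3 x + (Z3 x - c) * (Z3 x - c) - r - eps * cos (N * X3 x).

Definition dwavy (x h : 'rV[R]_3) : R :=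
  2 * (X3 x * X3 h + Y3 x * Y3 h + (Z3 x - c) * Z3 h) +
  eps * ((N * X3 h) * sin (N * X3 x)).

Lemma Ck_wavy (V : normedModType R) k (g : V -> 'rV[R]_3) :
  (forall i, Ck k setT (fun s => coord3 i (g s))) -> Ck k setT (fun s => wavy (g s)).
Proof.
move=> cg; rewrite /wavy; apply: CkB; last first.
  by apply: CkZ; apply: Ck_cos; apply: CkZ; exact: cg.
apply: CkB; last exact: Ck_cst.
apply: CkD; first by apply: CkD; apply: CkM; exact: cg.
by apply: CkM; apply: CkB; by [exact: cg|exact: Ck_cst].
Qed.

Lemma wavy_smooth : smooth_on setT wavy.
Proof.
move=> k; apply: (@Ck_wavy _ k id) => i.
exact: (@Ck_linear _ _ k (coord3 i) (@coord3_cts _ i)).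
Qed.

Lemma wavy_differentiable x : differentiable wavy x.
Proof. exact: Ck_differentiable (wavy_smooth 1). Qed.

Lemma diff_wavy x h : 'd wavy x h = dwavy x h.
Proof.
have iX := is_derive_coord3 (@Ordinal 3 0 isT) x h.
have iY := is_derive_coord3 (@Ordinal 3 1 isT) x h.
have iZ := is_deriveB (is_derive_coord3 (@Ordinal 3 2 isT) x h)
  (is_derive_cst (c : R^o) x h).
have dNX : differentiable (N *: X3 : 'rV[R]_3 -> R^o) x.
  by apply: differentiableZ; apply: linear_differentiable; exact: coord3_cts.
have iC : is_derive x h (fun y => cos ((N *: X3) y) : R^o)
    (- sin (N * X3 x) * (N * X3 h)).
  apply: DeriveDef; first by apply: diff_derivable; have [] := diff_cos_comp dNX.
  rewrite (derive_cos_comp h dNX); congr (_ * _).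
  by have [_ ->] := is_deriveZ N iX.
have iF := is_deriveB (is_deriveB (is_deriveD (is_deriveD (is_deriveM iX iX)
  (is_deriveM iY iY)) (is_deriveM iZ iZ)) (is_derive_cst (r : R^o) x h))
  (is_deriveZ eps iC).
rewrite -deriveE; last exact: wavy_differentiable.
have [_ e] := iF; rewrite [LHS]e /dwavy -![_ *: _]/(_ * _) !fctE /cst.
ring.
Qed.

Hypotheses (r0 : 0 < r) (eps0 : 0 <= eps) (epsN : eps * N ^+ 2 <= 1 / 2).

(** The sphere contributes |h|^2, of which by [cos_upper] the corrugation takes
    away at most eps N^2 <= 1/2. *)
Lemma wavy_above_tangent x h : h != 0 -> wavy x + dwavy x h < wavy (x + h).
Proof.
move=> hn0.
have h0 := sumsq_gt0 hn0.
have := sqr_ge0 (Z3 h); have := sqr_ge0 (Y3 h).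
have : eps * (N * X3 h) ^+ 2 <= 1 / 2 * X3 h ^+ 2.
  by rewrite exprMn mulrA ler_wpM2r // sqr_ge0.
have := ler_wpM2l eps0 (cos_upper (N * X3 x) (N * X3 h)).
rewrite /wavy /dwavy !coord3D [N * (_ + _)]mulrDr.
move: (cos _) (cos _) (sin _) => c1 c2 s1.
rewrite !expr2; lra.
Qed.

Lemma wavy_convex x y : x != y -> wavy x + 'D_(y - x) wavy x < wavy y.
Proof.
move=> xy; rewrite (deriveE _ (wavy_differentiable x)) diff_wavy.
have yx : y - x != 0 by rewrite subr_eq0 eq_sym.
by have := wavy_above_tangent x yx; rewrite [x + _]addrC subrK.
Qed.

Lemma wavy_oval : oval_equation wavy.
Proof.
split; [exact: wavy_smooth|exact: wavy_convex| |].
  exists (vec3 0 0 c); rewrite /wavy !vec3E subrr !mulr0 cos0 !add0r mulr1.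
  by rewrite -opprD oppr_lt0 ltr_wpDr.
exists (1 + r + eps + `|c|) => x fx.
have c1 : eps * cos (N * X3 x) <= eps by rewrite ler_piMr // cos_le1.
have B : X3 x * X3 x + Y3 x * Y3 x + (Z3 x - c) * (Z3 x - c) <= r + eps.
  by move: fx; rewrite /wavy; lra.
have sq (a : R) : `|a| <= 1 + a ^+ 2.
  by rewrite -[a ^+ 2]real_normK ?num_real //; have := sqr_ge0 (`|a| - 1/2); nra.
have hx := sqr_ge0 (X3 x); have hy := sqr_ge0 (Y3 x); have hz := sqr_ge0 (Z3 x - c).
have c0 := normr_ge0 c.
have bX := sq (X3 x); have bY := sq (Y3 x); have bZ := sq (Z3 x - c).
have bZ' : `|Z3 x| <= `|Z3 x - c| + `|c| by rewrite -{1}[Z3 x](subrK c) ler_normD.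
rewrite !expr2 in hx hy hz bX bY bZ.
rewrite [leLHS]/Num.norm /= mx_normrE; apply: bigmax_le => [|[i j] _ /=]; first by lra.
rewrite ord1; case: j => -[|[|[|//]]] H.
- rewrite (_ : Ordinal H = Ordinal (isT : (0 < 3)%N)); last exact: val_inj.
  rewrite -/(X3 x); lra.
- rewrite (_ : Ordinal H = Ordinal (isT : (1 < 3)%N)); last exact: val_inj.
  rewrite -/(Y3 x); lra.
- rewrite (_ : Ordinal H = Ordinal (isT : (2 < 3)%N)); last exact: val_inj.
  rewrite -/(Z3 x); lra.
Qed.

End WavySphere.

Lemma rowspan_scale_dir (R : realType) (x v : 'rV[R]_3) k : k != 0 ->
  rowspan (line_mx x (k *: v)) = rowspan (line_mx x v) :> {vspace 'rV[R]_4}.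
Proof.
move=> k0.
have sub (u : 'rV[R]_3) l : (line_mx x (l *: u) <= line_mx x u)%MS.
  rewrite {1}/line_mx col_mx_sub; apply/andP; split.
    by apply/homv_line; exists 0; rewrite scale0r addr0.
  by apply/dir_line; exists l.
apply/rowspanP/eqmxP; rewrite sub /=.
by have := sub (k *: v) k^-1; rewrite scalerA mulVf // scale1r.
Qed.

Lemma Omega1_oval_param (R : realType) (f : 'rV[R]_3 -> R^o) (Lam : Grass R 1 3) p v :
  oval_equation f -> val Lam = rowspan (line_mx p v) -> Omega1 (oval f) Lam ->
  exists t, f (p + t *: v) = 0 /\ 'd f (p + t *: v) v = 0.
Proof.
move=> of_ eL /(Omega1_ovalP of_)[x [u [u0 eV fx dx]]].
have /rowspanP eqL : rowspan (line_mx x u) = rowspan (line_mx p v) :> {vspace 'rV[R]_4}.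
  by rewrite -eV.
have /homv_line[s xs] : (homv x <= line_mx p v)%MS.
  by rewrite -eqL; apply/homv_line; exists 0; rewrite scale0r addr0.
have /dir_line[k dk] : (dir v <= line_mx x u)%MS.
  by rewrite eqL; apply/dir_line; exists 1; rewrite scale1r.
by exists s; rewrite -xs; split=> //; rewrite dk linearZ /= dx scaler0.
Qed.

Section WavyChart.
Context {R : realType}.
Variables (c r eps N : R).
Hypotheses (r0 : 0 < r) (eps0 : 0 <= eps) (epsN : eps * N ^+ 2 <= 1 / 2).
Let f := wavy c r eps N.

(** Along b + t d the derivative of the equation is linear in t up to the sine
    term; [wavy_a] and [wavy_b] are the coefficients. *)
Definition wavy_a (d : 'rV[R]_3) : R^o := 2 * (X3 d * X3 d + Y3 d * Y3 d + Z3 d * Z3 d).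
Definition wavy_b (b d : 'rV[R]_3) : R^o :=
  2 * (X3 b * X3 d + Y3 b * Y3 d + (Z3 b - c) * Z3 d).

Lemma dwavy_kepler b d t : dwavy c eps N (b + t *: d) d =
  kepler (wavy_a d) (wavy_b b d) eps (N * X3 b) (N * X3 d) t.
Proof.
rewrite /dwavy /kepler /wavy_a /wavy_b !coord3D !coord3Z.
have -> : N * (X3 b + t * X3 d) = N * X3 b + t * (N * X3 d) by ring.
ring.
Qed.

Lemma wavy_slope d : d != 0 -> `|eps| * (N * X3 d) ^+ 2 < wavy_a d.
Proof.
move=> d0; rewrite ger0_norm // exprMn mulrA.
have : eps * N ^+ 2 * X3 d ^+ 2 <= 1 / 2 * X3 d ^+ 2 by rewrite ler_wpM2r // sqr_ge0.
move=> /le_lt_trans; apply.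
have := sumsq_gt0 d0; rewrite /wavy_a.
have := sqr_ge0 (X3 d); rewrite expr2; have := sqr_ge0 (Y3 d); have := sqr_ge0 (Z3 d).
rewrite !expr2; lra.
Qed.

Variables (p v : 'rV[R]_3) (E : 'M[R]_(2, 3)).
Hypothesis basis : row_full (col_mx v E).
Let P : 'M[R]_(1.+1, 3.+1) := line_mx p v.
Let Q : 'M[R]_(3 - 1, 4) := E *m Qstd.

Lemma Ck_base k i : Ck k setT (fun A => coord3 i (base p E A)).
Proof.
pose l : {linear 'M[R]_2 -> R^o} := coord3 i \o (@usubmx R 1 1 3 \o mulmxr E).
have -> : (fun A => coord3 i (base p E A)) = fun A => coord3 i p + l A.
  by apply: funext => A; rewrite coord3D.
apply: CkD; first exact: Ck_cst.
by apply: Ck_linear; exact: mx_linear_continuous.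
Qed.

Lemma Ck_direction k i : Ck k setT (fun A => coord3 i (direction v E A)).
Proof.
pose l : {linear 'M[R]_2 -> R^o} := coord3 i \o (@dsubmx R 1 1 3 \o mulmxr E).
have -> : (fun A => coord3 i (direction v E A)) = fun A => coord3 i v + l A.
  by apply: funext => A; rewrite coord3D.
apply: CkD; first exact: Ck_cst.
by apply: Ck_linear; exact: mx_linear_continuous.
Qed.

Lemma wavy_critical : exists tau : 'M[R]_2 -> R^o, smooth_on setT tau /\
  forall A, 'd f (base p E A + tau A *: direction v E A) (direction v E A) = 0.
Proof.
pose a A := wavy_a (direction v E A).
pose b A := wavy_b (base p E A) (direction v E A).
pose al A : R^o := N * X3 (base p E A).
pose be A : R^o := N * X3 (direction v E A).
have slope A : `|eps| * be A ^+ 2 < a A.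
  by apply: wavy_slope; exact: direction_neq0.
have ex A : exists t, kepler (a A) (b A) eps (al A) (be A) t = 0.
  exact: kepler_exists.
have [tau tauP] := choice ex.
exists tau; split; last by move=> A; rewrite /f diff_wavy dwavy_kepler; exact: tauP.
apply: (kepler_smooth slope tauP) => k.
- apply: CkZ; apply: CkD; first by apply: CkD; apply: CkM; exact: Ck_direction.
  by apply: CkM; exact: Ck_direction.
- apply: CkZ; apply: CkD.
    by apply: CkD; apply: CkM; by [exact: Ck_base|exact: Ck_direction].
  apply: CkM; last exact: Ck_direction.
  by apply: CkB; [exact: Ck_base|exact: Ck_cst].
- by apply: CkZ; exact: Ck_base.
- by apply: CkZ; exact: Ck_direction.
Qed.

(** The instance of [Omega1_has_tangent_space] for corrugated spheres, with the
    tangent space given by its explicit linear form. *)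
Lemma wavy_Omega1_tangent (t : R) :
  f (p + t *: v) = 0 -> dwavy c eps N (p + t *: v) v = 0 ->
  exists T : {vspace 'M[R]_(2, 3 - 1)},
    has_tangent_space P Q 1 (Omega1 (oval f)) T /\
    forall B : 'M[R]_2, B \in T -> dwavy c eps N (p + t *: v)
      (usubmx (B *m E : 'M[R]_(1 + 1, 3)) +
       t *: dsubmx (B *m E : 'M[R]_(1 + 1, 3))) = 0.
Proof.
move=> ft dt; have of_ : oval_equation f by exact: wavy_oval.
have [tau [stau crit]] := wavy_critical.
have tE : t = tau 0.
  by apply: (contact_unique basis of_ crit); rewrite base0 direction0 /f diff_wavy.
have cE : contact p v E tau 0 = p + t *: v by rewrite /contact base0 direction0 tE.
have sdepth : smooth_on setT (depth p v E f tau).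
  move=> k; apply: Ck_wavy => i; rewrite /contact.
  have -> : (fun s => coord3 i (base p E s + tau s *: direction v E s)) =
    fun s => coord3 i (base p E s) + tau s * coord3 i (direction v E s).
    by apply: funext => A; rewrite coord3D coord3Z.
  by apply: CkD; [exact: Ck_base|apply: CkM; [exact: stau|exact: Ck_direction]].
have d0 : depth p v E f tau 0 = 0 by rewrite /depth cE.
exists (Omega1_tangent p v E f tau); split.
  exact: (Omega1_has_tangent_space basis of_ crit stau sdepth d0).
move=> B; rewrite memv_ker lfunE /= => /eqP.
rewrite (diff_depth of_ crit stau) cE -tE => e.
by rewrite -(diff_wavy c r eps N).
Qed.

End WavyChart.

(** * Three spheres with a common hyperboloid of tangent lines, and a corrugated one *)

Section Rulings.
Context {R : realType}.
Implicit Types a b s t : R.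

(** For a^2 + b^2 = 1 and s = 1 or -1, the line through [waist a b] directed by
    [ruling a b s] is a ruling of the hyperboloid x^2 + y^2 = 1 + z^2, and the
    rows of [ruling_compl] are orthogonal to it. *)
Definition waist a b : 'rV[R]_3 := vec3 a b 0.
Definition ruling a b s : 'rV[R]_3 := vec3 (- (s * b)) (s * a) 1.
Definition ruling_compl a b s : 'M[R]_(2, 3) :=
  col_mx (vec3 a b 0 : 'M[R]_(1, 3)) (vec3 (- (s * b)) (s * a) (-1)).

Lemma ruling_neq0 a b s : ruling a b s != 0.
Proof.
apply/eqP => /(congr1 (@coord3 R (@Ordinal 3 2 isT))) /eqP.
by rewrite vec3Z /coord3 mxE oner_eq0.
Qed.

Lemma compl_usub (e e' : 'rV[R]_3) (B : 'M[R]_2) :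
  usubmx (B *m (col_mx e e' : 'M[R]_(2, 3)) : 'M[R]_(1 + 1, 3)) =
  B 0 0 *: e + B 0 1 *: e'.
Proof.
rewrite -mul_usub_mx; have := mul_rV2_col_mx e e' (usubmx (B : 'M[R]_(1 + 1, 2))).
move=> ->; congr (_ *: _ + _ *: _); rewrite mxE; congr (B _ _); exact: val_inj.
Qed.

Lemma compl_dsub (e e' : 'rV[R]_3) (B : 'M[R]_2) :
  dsubmx (B *m (col_mx e e' : 'M[R]_(2, 3)) : 'M[R]_(1 + 1, 3)) =
  B 1 0 *: e + B 1 1 *: e'.
Proof.
rewrite -mul_dsub_mx; have := mul_rV2_col_mx e e' (dsubmx (B : 'M[R]_(1 + 1, 2))).
move=> ->; congr (_ *: _ + _ *: _); rewrite mxE; congr (B _ _); exact: val_inj.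
Qed.

Lemma ruling_basis a b s : a ^+ 2 + b ^+ 2 = 1 -> s ^+ 2 = 1 ->
  row_full (col_mx (ruling a b s) (ruling_compl a b s)).
Proof.
move=> ab s1; rewrite -sub1mx; apply/rV_subP => u _.
have tE (al be ga : R) : al *: ruling a b s +
    (be *: vec3 a b 0 + ga *: vec3 (- (s * b)) (s * a) (-1)) =
  row_mx al%:M (row_mx be%:M ga%:M : 'rV[R]_(1 + 1)) *m
    col_mx (ruling a b s) (ruling_compl a b s).
  rewrite mul_row_col mul_scalar_mx; congr (_ + _).
  by rewrite /ruling_compl mul_row_col !mul_scalar_mx.
pose w := s * (a * Y3 u - b * X3 u).
have -> : u = ((w + Z3 u) / 2) *: ruling a b s +
   ((a * X3 u + b * Y3 u) *: vec3 a b 0 +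
    ((w - Z3 u) / 2) *: vec3 (- (s * b)) (s * a) (-1)).
  have eX : X3 u = X3 u * (a ^+ 2 + b ^+ 2) by rewrite ab mulr1.
  have eY : Y3 u = Y3 u * (a ^+ 2 + b ^+ 2) by rewrite ab mulr1.
  have sw : s * w = a * Y3 u - b * X3 u by rewrite /w mulrA -expr2 s1 mul1r.
  apply: eq_vec3; rewrite !coord3D !coord3Z !vec3E.
  - rewrite [LHS]eX.
    transitivity ((a * X3 u + b * Y3 u) * a - b * (s * w)); last by field.
    by rewrite sw; ring.
  - rewrite [LHS]eY.
    transitivity ((a * X3 u + b * Y3 u) * b + a * (s * w)); last by field.
    by rewrite sw; ring.
  - by field.
by rewrite tE submxMl.
Qed.

End Rulings.

(** Here (x, y, z) is the point of contact with the unit sphere, (u, w, q)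
    directs the line, and t1, t2 are the parameters of its contacts with the two
    other spheres. The derivatives give t2 = - t1, then the equations give
    1 - 2 z = t1 q = 1 + 2 z. *)
Lemma tangent_three_spheres (R : realType) (x y z u w q t1 t2 : R) :
  0 < u * u + w * w + q * q ->
  x * x + y * y + z * z = 1 -> x * u + y * w + z * q = 0 ->
  (x + t1 * u) * (x + t1 * u) + (y + t1 * w) * (y + t1 * w) +
    (z + t1 * q - 2) * (z + t1 * q - 2) = 3 ->
  (x + t1 * u) * u + (y + t1 * w) * w + (z + t1 * q - 2) * q = 0 ->
  (x + t2 * u) * (x + t2 * u) + (y + t2 * w) * (y + t2 * w) +
    (z + t2 * q + 2) * (z + t2 * q + 2) = 3 ->
  (x + t2 * u) * u + (y + t2 * w) * w + (z + t2 * q + 2) * q = 0 ->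
  [/\ z = 0, t1 * q = 1 & u * u + w * w = q * q].
Proof.
move=> a0 e0 d0 f1 d1 f2 d2; set n := u * u + w * w + q * q in a0.
have n1 : t1 * n = 2 * q by rewrite /n; lra.
have n2 : t2 * n = - (2 * q) by rewrite /n; lra.
have t21 : t2 = - t1.
  by apply: (mulIf (lt0r_neq0 a0)); rewrite mulNr n1 n2.
have s1 : t1 * (t1 * n) = t1 * (2 * q) by rewrite n1.
have d1' : t1 * (x * u + y * w + z * q) = 0 by rewrite d0 mulr0.
have h1 : 1 - 2 * z = t1 * q by rewrite /n in s1; lra.
have h2 : 1 + 2 * z = t1 * q by rewrite /n in s1; rewrite t21 in f2; lra.
have z0 : z = 0 by lra.
have tq : t1 * q = 1 by lra.
have : q * (t1 * n) = q * (2 * q) by rewrite n1.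
rewrite mulrA [q * t1]mulrC tq mul1r /n => e.
by split=> //; lra.
Qed.

Section Configuration.
Context {R : realType}.
Variables (eps N : R).
Hypotheses (eps0 : 0 < eps) (N1 : 1 <= N).
Hypotheses (epsN : eps * N ^+ 2 = 1 / 2) (cosN1 : cos N = 1).

(** The unit sphere, the spheres of squared radius 3 about (0, 0, 2) and
    (0, 0, -2), and the corrugated unit sphere. *)
Definition zcenter (i : 'I_4) : R := nth 0 [:: 0; 2; -2; 0] i.
Definition sqradius (i : 'I_4) : R := nth 1 [:: 1; 3; 3; 1] i.
Definition amplitude (i : 'I_4) : R := nth 0 [:: 0; 0; 0; eps] i.
Definition config (i : 'I_4) : 'rV[R]_3 -> R^o :=
  wavy (zcenter i) (sqradius i) (amplitude i) N.
(** The parameter on the ruling, counted from the waist, of its contact with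
    each surface. *)
Definition param t (i : 'I_4) : R := nth 0 [:: 0; 1; -1; t] i.

Lemma config_hyps i :
  [/\ 0 < sqradius i, 0 <= amplitude i & amplitude i * N ^+ 2 <= 1 / 2].
Proof.
case: i => -[|[|[|[|//]]]] H; rewrite /sqradius /amplitude /=;
  split; rewrite ?ltr01 ?ltr0n // ?mul0r ?divr_ge0 ?ler01 ?ler0n //.
  exact: ltW.
by rewrite epsN.
Qed.

Lemma config_oval i : oval_equation (config i).
Proof. by have [] := config_hyps i; exact: wavy_oval. Qed.

Let touches i p v t := config i (p + t *: v) = 0 /\
  dwavy (zcenter i) (amplitude i) N (p + t *: v) v = 0.

Lemma touch_spheres a b s t (i : 'I_4) : a ^+ 2 + b ^+ 2 = 1 -> s ^+ 2 = 1 ->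
  (i < 3)%N -> touches i (waist a b) (ruling a b s) (param t i).
Proof.
rewrite !expr2 => ab s1.
have sab : s * s * (a * a + b * b) = 1 by rewrite s1 ab mulr1.
case: i => -[|[|[|[|//]]]] H // _;
  rewrite /touches /config /zcenter /sqradius /amplitude /param /=;
  rewrite /wavy /dwavy !coord3D !coord3Z !vec3E !mul0r ?mul1r ?subr0 ?addr0; split; lra.
Qed.

(** For p the point of contact with the unit sphere, [tangent_three_spheres] puts
    p on the waist circle and makes v, up to scaling, the direction of a ruling
    through p. *)
Lemma common_lines (Lam : Grass R 1 3) : (forall i, Omega1 (oval (config i)) Lam) ->
  exists a b s t, [/\ a ^+ 2 + b ^+ 2 = 1, s ^+ 2 = 1,
    val Lam = rowspan (line_mx (waist a b) (ruling a b s)) &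
    forall i, touches i (waist a b) (ruling a b s) (param t i)].
Proof.
move=> om.
have par p v : val Lam = rowspan (line_mx p v) ->
    forall i, exists t, touches i p v t.
  move=> eL i; have [t [h1 h2]] := Omega1_oval_param (config_oval i) eL (om i).
  by exists t; split=> //; rewrite -h2 /config diff_wavy.
pose i0 : 'I_4 := Ordinal (isT : (0 < 4)%N).
pose i1 : 'I_4 := Ordinal (isT : (1 < 4)%N).
pose i2 : 'I_4 := Ordinal (isT : (2 < 4)%N).
pose i3 : 'I_4 := Ordinal (isT : (3 < 4)%N).
have /(Omega1_ovalP (config_oval i0))[p [v [v0 eL f0 d0]]] := om i0.
have [t1 [f1 d1]] := par _ _ eL i1.
have [t2 [f2 d2]] := par _ _ eL i2.
move: f0 d0 f1 d1 f2 d2.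
rewrite /config diff_wavy /wavy /dwavy /zcenter /sqradius /amplitude /=.
rewrite !mul0r !subr0 !addr0 !coord3D !coord3Z => f0 d0 f1 d1 f2 d2.
have [||||||z0 tq uw] := @tangent_three_spheres R (X3 p) (Y3 p) (Z3 p)
  (X3 v) (Y3 v) (Z3 v) t1 t2 (sumsq_gt0 v0).
- lra.
- lra.
- lra.
- lra.
- lra.
- lra.
have q0 : Z3 v != 0 by apply: contra_eq_neq tq => ->; rewrite mulr0 eq_sym oner_eq0.
pose a : R := X3 p; pose b : R := Y3 p.
(* Up to the factor Z3 v, the horizontal part of v is (a, b) turned by a right
   angle, to the side given by s. *)
pose s : R := (a * Y3 v - b * X3 v) / Z3 v.
have sq : s * Z3 v = a * Y3 v - b * X3 v by rewrite /s divfK.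
have ab : a ^+ 2 + b ^+ 2 = 1 by rewrite !expr2 /a /b; rewrite z0 in f0; lra.
have perp : a * X3 v + b * Y3 v = 0 by rewrite /a /b; rewrite z0 in d0; lra.
have vE : v = Z3 v *: ruling a b s.
  apply: eq_vec3; rewrite coord3Z vec3E ?mulr1 //.
  - transitivity (- b * (s * Z3 v)); last by ring.
    rewrite sq -[LHS]mulr1 -[X in _ * X]ab.
    transitivity (a * (a * X3 v + b * Y3 v) - b * (a * Y3 v - b * X3 v)); first by ring.
    by rewrite perp; ring.
  - transitivity (a * (s * Z3 v)); last by ring.
    rewrite sq -[LHS]mulr1 -[X in _ * X]ab.
    transitivity (b * (a * X3 v + b * Y3 v) + a * (a * Y3 v - b * X3 v)); first by ring.
    by rewrite perp; ring.
have s1 : s ^+ 2 = 1.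
  have qq : Z3 v * Z3 v != 0 by rewrite mulf_neq0.
  apply: (mulIf qq); rewrite mul1r -[RHS]uw.
  transitivity ((s * Z3 v) ^+ 2); first by ring.
  rewrite sq.
  transitivity ((X3 v * X3 v + Y3 v * Y3 v) * (a ^+ 2 + b ^+ 2)); last first.
    by rewrite ab mulr1.
  transitivity ((X3 v * X3 v + Y3 v * Y3 v) * (a ^+ 2 + b ^+ 2) -
    (a * X3 v + b * Y3 v) ^+ 2).
    by ring.
  by rewrite perp; ring.
have pE : p = waist a b by apply: eq_vec3; rewrite vec3E.
have eL' : val Lam = rowspan (line_mx (waist a b) (ruling a b s)).
  by rewrite eL pE {1}vE rowspan_scale_dir.
have [t [f3 d3]] := par _ _ eL' i3.
exists a, b, s, t; split=> // i.
have [i_lt|] := ltnP i 3; first exact: touch_spheres.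
rewrite leq_eqVlt ltnNge -ltnS ltn_ord orbF => /eqP i_eq.
by rewrite (_ : i = i3) //; apply: val_inj; rewrite /= -i_eq.
Qed.

(** For a sphere the derivative along this displacement is 2 (al + c0 be): it
    depends on the height c0 of the centre only. *)
Lemma dwavy_ruling c0 e a b s t al be : a ^+ 2 + b ^+ 2 = 1 -> s ^+ 2 = 1 ->
  dwavy c0 e N (waist a b + t *: ruling a b s)
    (al *: vec3 a b 0 + be *: vec3 (- (s * b)) (s * a) (-1)) =
  2 * (al + c0 * be) + e * (N * (al * a - be * (s * b)) * sin (N * (a - t * (s * b)))).
Proof.
rewrite !expr2 => ab s1; rewrite /dwavy !coord3D !coord3Z !vec3E mulr0 add0r mulr1.
have -> : (a + t * - (s * b)) = a - t * (s * b) by ring.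
congr (2 * _ + _ * (_ * _ * _)); last by ring.
transitivity (al * (a * a + b * b) + t * be * (s * s) * (a * a + b * b) -
  t * be + c0 * be).
  by ring.
by rewrite ab s1; ring.
Qed.

(** If the sine vanished, so would t and then the cosine. If the second
    factor, the ordinate of the contact point, vanished, the bound
    eps N <= 1/2 would again force t = 0, so that the cosine would be 0; but the
    contact would be at (1, 0, 0) or (-1, 0, 0), where the cosine is
    cos N = 1. *)
Lemma wave_transverse a b s t : a ^+ 2 + b ^+ 2 = 1 -> s ^+ 2 = 1 ->
  wavy 0 1 eps N (waist a b + t *: ruling a b s) = 0 ->
  dwavy 0 eps N (waist a b + t *: ruling a b s) (ruling a b s) = 0 ->
  4 * t = eps * N * (s * b) * sin (N * (a - t * (s * b))) /\
  sin (N * (a - t * (s * b))) * (b + t * (s * a)) != 0.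
Proof.
rewrite !expr2 => ab s1; rewrite /wavy /dwavy !coord3D !coord3Z !vec3E.
rewrite ?mulr0 ?add0r ?mulr1 ?subr0 !mulrN.
have sab : s * s * (a * a + b * b) = 1 by rewrite s1 ab mulr1.
have C2 := cos2Dsin2 (N * (a - t * (s * b))); move: C2.
have := sin_max (N * (a - t * (s * b))).
have : t = 0 -> b = 0 -> cos (N * (a - t * (s * b))) = 1.
  move=> -> b0; rewrite b0 !mul0r subr0.
  have /eqP : a ^+ 2 = 1 by rewrite expr2 -ab b0; ring.
  by rewrite sqrf_eq1 => /orP[]/eqP ->; rewrite ?mulr1 // mulrN1 cosN.
move: (sin _) (cos _) => S C C1 S1 CS f0 d0.
have tsab : t * (s * s * (a * a + b * b)) = t by rewrite sab mulr1.
have ttsab : t * t * (s * s * (a * a + b * b)) = t * t by rewrite sab mulr1.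
have tS : 4 * t = eps * N * (s * b) * S by lra.
have tC : 2 * (t * t) = eps * C by lra.
split=> //; rewrite mulf_neq0 //.
  apply/eqP => S0; have t0 : t = 0 by move: tS; rewrite S0 mulr0; lra.
  move: tC; rewrite t0 !mulr0 => /esym/eqP; rewrite mulf_eq0 gt_eqF //= => /eqP C0.
  by move: CS; rewrite S0 C0 expr0n /= addr0 => /eqP; rewrite eq_sym oner_eq0.
apply/eqP => Y0.
have sb : s * b = - (t * a).
  transitivity (s * (b + t * (s * a)) - t * a * (s * s)); first by ring.
  by rewrite Y0 s1; ring.
have eN : eps * N <= 1 / 2.
  rewrite -epsN expr2; apply: ler_wpM2l; first exact: ltW.
  by rewrite ler_peMr // (le_trans ler01 N1).
have eN0 : 0 <= eps * N by apply: mulr_ge0; [exact: ltW|exact: le_trans ler01 N1].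
have aS : `|a * S| <= 1.
  rewrite normrM mulr_ile1 // -(@expr_le1 _ 2) // real_normK ?num_real // expr2 -ab.
  by rewrite lerDl -expr2 sqr_ge0.
have t0 : t = 0.
  have /eqP : t * (4 + eps * N * (a * S)) = 0 by rewrite mulrDr [t * 4]mulrC tS sb; ring.
  rewrite mulf_eq0 => /orP[/eqP//|/eqP e]; exfalso.
  have : `|eps * N * (a * S)| <= 1 / 2.
    by rewrite normrM ger0_norm // -[leRHS]mulr1 ler_pM.
  by rewrite ler_norml => /andP[+ _]; lra.
have b0 : b = 0 by move: Y0; rewrite t0 mul0r addr0.
by move: tC; rewrite (C1 t0 b0) t0 !mulr0 mulr1 => e; move: eps0; rewrite -e ltxx.
Qed.

(** The forms of the three spheres vanish together only when B 0 0 = B 1 1 = 0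
    and B 1 0 = - 2 B 0 1, the rotations about the z-axis; by
    [wave_transverse] the fourth form does not vanish on these. *)
Lemma config_transverse : transverse_intersection (fun i => Omega1 (oval (config i))).
Proof.
move=> Lam /common_lines[a [b [s [t [ab s1 eL touch]]]]].
have basis := ruling_basis ab s1.
have exT i : exists T : {vspace 'M[R]_(2, 3 - 1)},
    has_tangent_space (line_mx (waist a b) (ruling a b s) : 'M[R]_(1.+1, 3.+1))
      (ruling_compl a b s *m Qstd : 'M[R]_(3 - 1, 4)) 1 (Omega1 (oval (config i))) T /\
    forall B : 'M[R]_2, B \in T -> dwavy (zcenter i) (amplitude i) N
      (waist a b + param t i *: ruling a b s)
      ((B 0 0 + param t i * B 1 0) *: vec3 a b 0 +
       (B 0 1 + param t i * B 1 1) *: vec3 (- (s * b)) (s * a) (-1)) = 0.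
  have [h1 h2 h3] := config_hyps i; have [ft dt] := touch i.
  have [T [hT kT]] := wavy_Omega1_tangent h1 h2 h3 basis ft dt.
  exists T; split=> // B /kT; rewrite compl_usub compl_dsub.
  move=> e; rewrite -[RHS]e; congr (dwavy _ _ _ _ _).
  by rewrite scalerDr !scalerA !scalerDl addrACA.
have [T TP] := choice exT.
exists (line_mx (waist a b) (ruling a b s)), (ruling_compl a b s *m Qstd), T; split.
- by split; [exact: line_frame|exact: esym].
- by move=> i; case: (TP i).
suff -> : (\bigcap_i T i)%VS = 0%VS by rewrite dimv0 dimvf dim_matrix.
apply/eqP; rewrite -subv0; apply/subvP => B BT.
have BTi i : B \in T i by apply: (subvP (bigcapv_inf i _ (subvv _))) BT.
pose i0 : 'I_4 := Ordinal (isT : (0 < 4)%N).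
pose i1 : 'I_4 := Ordinal (isT : (1 < 4)%N).
pose i2 : 'I_4 := Ordinal (isT : (2 < 4)%N).
pose i3 : 'I_4 := Ordinal (isT : (3 < 4)%N).
have := (TP i0).2 B (BTi i0); have := (TP i1).2 B (BTi i1).
have := (TP i2).2 B (BTi i2); have := (TP i3).2 B (BTi i3).
have [f3 d3] := touch i3; have [tS SY] := wave_transverse ab s1 f3 d3.
rewrite !dwavy_ruling // /zcenter /amplitude /param /=.
rewrite !mul0r !mul1r !addr0 => e3 e2 e1 e0.
move: SY tS e3; set S := sin _ => SY tS e3.
have B00 : B 0 0 = 0 by lra.
have B11 : B 1 1 = 0 by lra.
have B10 : B 1 0 = - (2 * B 0 1) by lra.
have B01 : B 0 1 = 0.
  have sS : s * (S * (b + t * (s * a))) = S * (s * b + t * a).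
    by transitivity (S * (s * b + t * a * (s ^+ 2))); [ring|rewrite s1 mulr1].
  have : 2 * (eps * N) * (s * (S * (b + t * (s * a)))) * B 0 1 = 0.
    rewrite sS; rewrite B00 B11 B10 in e3.
    have tS' : 4 * t * B 0 1 = eps * N * (s * b) * S * B 0 1 by rewrite tS.
    by lra.
  have N0 : N != 0 by rewrite gt_eqF // (lt_le_trans ltr01 N1).
  have s0 : s != 0 by apply: contra_eq_neq s1 => ->; rewrite expr0n /= eq_sym oner_eq0.
  have c0 : 2 * (eps * N) * (s * (S * (b + t * (s * a)))) != 0.
    by apply: mulf_neq0; apply: mulf_neq0 => //; rewrite mulf_neq0 // gt_eqF.
  by move/eqP; rewrite mulf_eq0 (negPf c0) => /eqP.
rewrite memv0; apply/eqP/matrixP => i j; rewrite [RHS]mxE.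
rewrite B01 mulr0 oppr0 in B10.
have val01 (k : 'I_2) : k = 0 \/ k = 1.
  by case: k => -[|[|//]] H; [left|right]; exact: val_inj.
by case: (val01 i) => ->; case: (val01 j) => ->.
Qed.

End Configuration.

(** * Counting the common tangent lines *)

Section Counting.
Context {R : realType}.
Variables (eps N : R).
Hypotheses (eps0 : 0 < eps) (epsN : eps * N ^+ 2 = 1 / 2).

Let height (u : R) : R := Num.sqrt (1 - u ^+ 2).
Let p u := waist u (height u).
Let v u := ruling u (height u) 1.
Let f := wavy 0 1 eps N.

Lemma Omega1_config a b s t : a ^+ 2 + b ^+ 2 = 1 -> s ^+ 2 = 1 ->
  wavy 0 1 eps N (waist a b + t *: ruling a b s) = 0 ->
  dwavy 0 eps N (waist a b + t *: ruling a b s) (ruling a b s) = 0 ->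
  forall i, Omega1 (oval (config eps N i)) (line (waist a b) (ruling_neq0 a b s)).
Proof.
move=> ab s1 f3 d3 i.
have [fi di] : config eps N i (waist a b + param t i *: ruling a b s) = 0 /\
    dwavy (zcenter i) (amplitude eps i) N
      (waist a b + param t i *: ruling a b s) (ruling a b s) = 0.
  have [i_lt|] := ltnP i 3; first exact: touch_spheres.
  rewrite leq_eqVlt ltnNge -ltnS ltn_ord orbF => /eqP i_eq.
  by rewrite (_ : i = Ordinal (isT : (3 < 4)%N)) //; apply: val_inj; rewrite /= -i_eq.
apply: (Omega1_oval_line (config_oval eps0 epsN i) (ruling_neq0 a b s) _ fi).
  by rewrite /= line_slide.
by rewrite /config diff_wavy.
Qed.

Lemma wavy_at_ruling a b t : a ^+ 2 + b ^+ 2 = 1 ->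
  f (waist a b + t *: ruling a b 1) = 2 * t ^+ 2 - eps * cos (N * (a - t * b)).
Proof.
move=> ab; rewrite /f /wavy !coord3D !coord3Z !vec3E !mul1r.
rewrite mulr1 add0r subr0 mulrN; move: (cos _) => C.
have : t * t * (a ^+ 2 + b ^+ 2) = t * t by rewrite ab mulr1.
lra.
Qed.

(** At both ends the sine vanishes, so the minimum of f on the ruling is attained
    on the waist, where f is - eps or eps. *)
Lemma wave_root ul ur : 0 <= ul -> ul <= ur -> ur <= 1 ->
  cos (N * ul) = 1 -> cos (N * ur) = -1 ->
  exists u t, [/\ ul <= u <= ur, u ^+ 2 + height u ^+ 2 = 1,
    f (p u + t *: v u) = 0 & dwavy 0 eps N (p u + t *: v u) (v u) = 0].
Proof.
move=> ul0 ulr ur1 cl cr.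
have e0 : 0 <= eps by exact: ltW.
have eN : eps * N ^+ 2 <= 1 / 2 by rewrite epsN.
have circle u : 0 <= u -> u <= 1 -> u ^+ 2 + height u ^+ 2 = 1.
  move=> u0 u1; rewrite /height sqr_sqrtr; first by ring.
  by rewrite subr_ge0 expr_le1.
have slope u := wavy_slope e0 eN (ruling_neq0 u (height u) 1).
have ex u : exists t, kepler (wavy_a (v u)) (wavy_b 0 (p u) (v u)) eps
    (N * X3 (p u)) (N * X3 (v u)) t = 0.
  exact/kepler_exists/slope.
have [tau tauP] := choice ex.
have crit u : dwavy 0 eps N (p u + tau u *: v u) (v u) = 0 by rewrite dwavy_kepler.
have ch : continuous (height : R^o -> R^o).
  move=> u; apply: (@continuous_comp _ _ _
    (fun u : R^o => 1 - u ^+ 2 : R^o) (@Num.sqrt R)).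
    apply: (@continuousB R R^o); first exact: cst_continuous.
    by apply: (@continuousM _ _ id id); exact: cvg_id.
  exact: sqrt_continuous.
have cid : continuous (id : R^o -> R^o) by move=> u; exact: cvg_id.
have cst (e : R^o) : continuous (fun _ : R^o => e) by exact: cst_continuous.
have cM (g h : R^o -> R^o) : continuous g -> continuous h ->
    continuous (fun u => g u * h u : R^o).
  by move=> cg ch' u; apply: continuousM; [exact: cg|exact: ch'].
have cD (g h : R^o -> R^o) : continuous g -> continuous h ->
    continuous (fun u => g u + h u : R^o).
  by move=> cg ch' u; apply: (@continuousD R R^o); [exact: cg|exact: ch'].
have cN (g : R^o -> R^o) : continuous g -> continuous (fun u => - g u : R^o).
  by move=> cg u; apply: (@continuousN R R^o); exact: cg.
have cpi i : continuous (fun u : R^o => coord3 i (p u)).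
  case: i => -[|[|[|//]]] H; rewrite /p /waist /coord3.
  - by have -> : (fun u : R^o => vec3 u (height u) 0 0 (Ordinal H)) = id
      by apply: funext => u; rewrite mxE.
  - by have -> : (fun u : R^o => vec3 u (height u) 0 0 (Ordinal H)) = height
      by apply: funext => u; rewrite mxE.
  - by have -> : (fun u : R^o => vec3 u (height u) 0 0 (Ordinal H)) = fun=> 0
      by apply: funext => u; rewrite mxE.
have cvi i : continuous (fun u : R^o => coord3 i (v u)).
  case: i => -[|[|[|//]]] H; rewrite /v /ruling /coord3.
  - have -> : (fun u : R^o => vec3 (- (1 * height u)) (1 * u) 1 0 (Ordinal H)) =
        fun u => - height u.
      by apply: funext => u; rewrite mxE /= mul1r.
    exact: cN.
  - by have -> : (fun u : R^o => vec3 (- (1 * height u)) (1 * u) 1 0 (Ordinal H)) = id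
      by apply: funext => u; rewrite mxE /= mul1r.
  - by have -> : (fun u : R^o => vec3 (- (1 * height u)) (1 * u) 1 0 (Ordinal H)) = fun=> 1
      by apply: funext => u; rewrite mxE.
have ctau : continuous (tau : R^o -> R^o).
  move=> u; apply: (kepler_continuous _ _ _ _ slope tauP).
  - apply: (cM) => //; apply: (cD); first by apply: (cD); apply: (cM); exact: cvi.
    by apply: (cM); exact: cvi.
  - apply: (cM) => //; apply: (cD).
      by apply: (cD); apply: (cM); by [exact: cpi|exact: cvi].
    by apply: (cM); [apply: (cD) => //; exact: cpi|exact: cvi].
  - by apply: (cM) => //; exact: cpi.
  - by apply: (cM) => //; exact: cvi.
pose M (u : R^o) : R^o := 2 * (tau u * tau u) - eps * cos (N * (u - tau u * height u)).
have cMM : continuous M.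
  apply: (cD); first by apply: (cM) => //; exact: cM.
  apply: (cN); apply: (cM) => //.
  move=> u; apply: (@continuous_comp _ _ _
    (fun u : R^o => N * (u - tau u * height u) : R^o) (@cos R)).
    by apply: (cM) => //; apply: (cD) => //; apply: (cN); exact: cM.
  exact: continuous_cos.
have ME u : 0 <= u -> u <= 1 -> f (p u + tau u *: v u) = M u.
  by move=> u0 u1; rewrite wavy_at_ruling ?circle // expr2.
have ul1 : ul <= 1 by exact: le_trans ur1.
have ur0 : 0 <= ur by exact: le_trans ulr.
(* The sine vanishes, hence the critical point is the waist point. *)
have tau0 u : `|cos (N * u)| = 1 -> tau u = 0.
  move=> /cos1sin0 S; apply: kepler_inj (slope u) (tauP u) _.
  rewrite /kepler /wavy_b !vec3E mul0r addr0 S !mulr0 addr0 add0r.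
  by ring.
have Ml : M ul <= 0.
  rewrite /M tau0 ?cl ?normr1 // !mul0r mulr0 subr0 cl mulr1 sub0r.
  by rewrite oppr_le0.
have Mr : 0 <= M ur.
  by rewrite /M tau0 ?cr ?normrN ?normr1 // !mul0r mulr0 subr0 cr mulrN1 opprK add0r.
have [|||u ulu Mu] := @IVT R M ul ur 0 => //.
- exact: continuous_subspaceT.
- by rewrite ge_min le_max Ml Mr orbT.
move: ulu; rewrite in_itv /= => /andP[u1 u2].
have u0 : 0 <= u by exact: le_trans u1.
have u11 : u <= 1 by exact: le_trans ur1.
by exists u, (tau u); split; [rewrite u1|exact: circle|rewrite ME|].
Qed.

End Counting.

Section Many.
Context {R : realType}.

Lemma cos_2pi_nat j : cos ((pi *+ 2) *+ j : R) = 1.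
Proof. by rewrite -[_ *+ j]add0r (periodicn (@cosD2pi R)) cos0. Qed.

Lemma cos_odd_pi j : cos ((pi *+ 2) *+ j + pi : R) = -1.
Proof. by rewrite cosDpi cos_2pi_nat. Qed.

Lemma ruling_line_inj (a b s a' b' s' : R) :
  rowspan (line_mx (waist a b) (ruling a b s)) =
  rowspan (line_mx (waist a' b') (ruling a' b' s')) :> {vspace 'rV[R]_4} -> a = a'.
Proof.
move=> /rowspanP E.
have /homv_line[t e] : (homv (waist a b) <= line_mx (waist a' b') (ruling a' b' s'))%MS.
  by rewrite -E; apply/homv_line; exists 0; rewrite scale0r addr0.
have := congr1 (@coord3 R (@Ordinal 3 2 isT)) e.
rewrite coord3D coord3Z !vec3Z add0r mulr1 => t0.
have := congr1 (@coord3 R (@Ordinal 3 0 isT)) e.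
by rewrite coord3D coord3Z !vec3X -t0 mul0r addr0.
Qed.

(** The ruling number j meets the waist at an abscissa between j / m and
    (j + 1/2) / m, an interval on which cos (N x) goes from 1 to -1. *)
Lemma config_many (m : nat) (eps : R) (N := (pi *+ 2) *+ m : R) : (0 < m)%N ->
  0 < eps -> eps * N ^+ 2 = 1 / 2 ->
  (`I_m #<= \bigcap_i Omega1 (oval (config eps N i)))%card.
Proof.
move=> m0 eps0 epsN.
have mR : 0 < m%:R :> R by rewrite ltr0n.
have ex j : exists Lam : Grass R 1 3, (j < m)%N ->
    (forall i, Omega1 (oval (config eps N i)) Lam) /\
    exists a b s : R, j%:R / m%:R <= a <= (j%:R + 1 / 2) / m%:R /\
      val Lam = rowspan (line_mx (waist a b) (ruling a b s)).
  have [jm|jm] := ltnP j m; last first.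
    by exists (line (waist 0 0) (ruling_neq0 0 0 1)).
  have NE (x : R) : N * (x / m%:R) = (pi *+ 2) * x.
    by rewrite /N -[_ *+ m]mulr_natr; field; rewrite gt_eqF.
  have [||||| u [t [ju circle f0 d0]]] :=
      @wave_root R eps N eps0 epsN (j%:R / m%:R) ((j%:R + 1 / 2) / m%:R).
  - by rewrite divr_ge0.
  - by rewrite ler_pM2r ?invr_gt0 // lerDl divr_ge0.
  - rewrite ler_pdivrMr // mul1r.
    have : j%:R + 1 <= m%:R :> R by rewrite natr1 ler_nat.
    lra.
  - by rewrite NE mulr_natr cos_2pi_nat.
  - rewrite NE mulrDr mulr_natr (_ : pi *+ 2 * (1 / 2) = pi :> R) ?cos_odd_pi //.
    by rewrite -mulr_natr; field.
  exists (line (waist u (Num.sqrt (1 - u ^+ 2)))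
    (ruling_neq0 u (Num.sqrt (1 - u ^+ 2)) 1)) => _; split.
    by apply: (Omega1_config eps0 epsN circle _ f0 d0); rewrite expr1n.
  by exists u, (Num.sqrt (1 - u ^+ 2)), 1; split.
have [g gP] := choice ex.
have inj : {in `I_m &, injective g}.
  move=> i j; rewrite !inE /= => im jm gij.
  have [_ [a [b [s [ia eL]]]]] := gP _ im; have [_ [a' [b' [s' [ja eL']]]]] := gP _ jm.
  have aa : a = a' by apply: (@ruling_line_inj a b s a' b' s'); rewrite -eL -eL' gij.
  have key k l (x : R) : k%:R / m%:R <= x -> x <= (l%:R + 1 / 2) / m%:R -> (k <= l)%N.
    move=> h1 h2; have := le_trans h1 h2; rewrite ler_pM2r ?invr_gt0 // => h.
    rewrite -ltnS -(ltr_nat R) -natr1; lra.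
  move: ia ja; rewrite aa => /andP[i1 i2] /andP[j1 j2].
  by apply/eqP; rewrite eqn_leq (key _ _ _ i1 j2) (key _ _ _ j1 i2).
rewrite -(card_le_eql (inj_card_eq inj)); apply: subset_card_le.
by move=> _ [j jm <-] i _; exact: (gP _ jm).1.
Qed.

End Many.

Local Close Scope ring_scope.

Theorem mainTheorem6 (R : realType) (m : nat) (hm : (0 < m)%N) :
  exists X : 'I_4 -> set (RP R 3),
    (forall i, convex_hypersurface (X i)) /\
    transverse_intersection (fun i => Omega1 (X i)) /\
    (`I_m #<= \bigcap_i Omega1 (X i))%card.
Proof.
pose N : R := ((pi *+ 2) *+ m)%R.
have N1 : (1 <= N)%R.
  have h : (1 <= m%:R :> R)%R by rewrite ler1n.
  by have := pi_ge2 R; rewrite /N -mulr_natr -[(pi *+ 2)%R]mulr_natr; nra.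
have N0 : (0 < N)%R by exact: lt_le_trans N1.
pose eps : R := ((2 * N ^+ 2)^-1)%R.
have eps0 : (0 < eps)%R by rewrite invr_gt0 mulr_gt0 // exprn_gt0.
have epsN : (eps * N ^+ 2 = 1 / 2)%R by rewrite /eps invfM mulfVK ?div1r // expf_neq0 // gt_eqF.
exists (fun i => oval (config eps N i)); split; [|split].
- by move=> i; apply: oval_convex_hypersurface; exact: config_oval.
- by apply: config_transverse => //; exact: cos_2pi_nat.
- exact: config_many.
Qed.
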